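(* Let $\mathbb{F}$ be a field and let $R(s)\in\mathbb{F}(s)^{m\times n}$ be a rational matrix with $\operatorname{rank}(R(s))=r$. Let $\frac{\eta_1(s)}{\varphi_1(s)},\dots,\frac{\eta_r(s)}{\varphi_r(s)}$ be its invariant rational functions and $\mathbf{c}=(c_1,\dots,c_{n-r})$ its column minimal indices. Let $z,x$ be integers such that $0\le x\le\min\{z,n-r\}$, let $\epsilon_1(s)\mid\dots\mid\epsilon_{r+x}(s)$ and $\psi_{r+x}(s)\mid\dots\mid\psi_1(s)$ be monic polynomials such that $\frac{\epsilon_i(s)}{\psi_i(s)}$ is an irreducible rational function for $1\le i\le r+x$, and let $\mathbf{d}=(d_1,\dots,d_{n-r-x})$ be a partition. Let $h_x=\min\{i:d_{i-x+1}<c_i\}$. There exists a rational matrix $\widetilde W(s)\in\mathbb{F}(s)^{z\times n}$ such that $\operatorname{rank}\begin{bmatrix}R(s)\\\widetilde W(s)\end{bmatrix}=r+x$ and $\begin{bmatrix}R(s)\\\widetilde W(s)\end{bmatrix}$ has $\frac{\epsilon_1(s)}{\psi_1(s)},\dots,\frac{\epsilon_{r+x}(s)}{\psi_{r+x}(s)}$ as invariant rational functions and $\mathbf{d}$ as column minimal indices if and only if all of the following hold: $$d_i=c_{i+x},\quad h_x-x+1\le i\le n-r-x,$$ $$\epsilon_i(s)\mid\eta_i(s)\mid\epsilon_{i+z}(s),\quad 1\le i\le r,$$ $$\psi_{i+z}(s)\mid\varphi_i(s)\mid\psi_i(s),\quad 1\le i\le r.$$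
   Context: Structural data. $\mathbb{F}(s)$ is the field of rational functions over $\mathbb{F}$. The rank of a matrix is its rank over $\mathbb{F}(s)$. The invariant rational functions of a rational matrix of rank $r$ are the irreducible fractions $\frac{\eta_1}{\varphi_1},\dots,\frac{\eta_r}{\varphi_r}$ of monic polynomials, with $\eta_1\mid\dots\mid\eta_r$ and $\varphi_r\mid\dots\mid\varphi_1$, on the diagonal of its Smith–McMillan form (the canonical form $\begin{bmatrix}\operatorname{diag}(\eta_1/\varphi_1,\dots,\eta_r/\varphi_r)&0\\0&0\end{bmatrix}$ under left and right multiplication by unimodular polynomial matrices). For a subspace of $\mathbb{F}(s)^{k\times 1}$, a minimal basis is a basis of polynomial vectors whose sum of degrees is least among all polynomial bases; the degrees of its vectors (independent of the choice) are the minimal indices of the subspace. The column minimal indices of $R(s)\in\mathbb{F}(s)^{m\times n}$ are the minimal indices of $\{y\in\mathbb{F}(s)^{n\times1}:R y=0\}$, always listed in decreasing order; there are $n-r$ of them if $R$ has rank $r$. Conventions. ''Decreasing'' is meant in the weak sense. A partition is a decreasing sequence of nonnegative integers (possibly empty). A decreasing sequence $a_1\ge\dots\ge a_k$ is extended by $a_i=+\infty$ for $i<1$ and $a_i=-\infty$ for $i>k$. (So if $x=0$ then $h_0=0$.) A chain $\epsilon_1\mid\dots\mid\epsilon_k$ is extended by $\epsilon_i=1$ for $i<1$ and $\epsilon_i=0$ for $i>k$; a chain $\psi_k\mid\dots\mid\psi_1$ is extended by $\psi_i=1$ for $i>k$ and $\psi_i=0$ for $i<1$. A condition over an empty index range is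 trivially satisfied. *)

(* Defs.v *)
From mathcomp Require Import all_boot all_order all_algebra.
From mathcomp Require Import constructive_ereal.

Set Implicit Arguments.
Unset Strict Implicit.
Unset Printing Implicit Defensive.

Import Order.TTheory GRing.Theory Num.Theory.

Local Open Scope ring_scope.

(* The list s = [:: s_1; ..; s_k], indexed from 1 as s_1, .., s_k, extended to
   all integer indices by lo for i < 1 and by hi for i > k. *)
Definition ext (T : Type) (lo hi : T) (s : seq T) (i : int) : T :=
  if i < 1 then lo else nth hi s `|i - 1|%N.

Definition ext_ind (s : seq nat) : int -> \bar int :=
  ext +oo%E -oo%E [seq (k%:Z)%:E%E | k <- s].

Definition is_min_int (P : int -> Prop) (h : int) : Prop :=
  P h /\ forall i : int, P i -> h <= i.

Notation ratfun F := {fraction {poly F}}.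

Section Rational.
Variable F : fieldType.

Definition poly_mx m n (A : 'M[{poly F}]_(m, n)) : 'M[ratfun F]_(m, n) :=
  map_mx (@tofrac {poly F}) A.

Definition ext_num (s : seq {poly F}) : int -> {poly F} := ext 1 0 s.
Definition ext_den (s : seq {poly F}) : int -> {poly F} := ext 0 1 s.

Definition irreducible_fractions (etas phis : seq {poly F}) : bool :=
  [&& all (fun p => p \is monic) etas, all (fun p => p \is monic) phis
    & all2 (@coprimep F) etas phis].

Definition div_chains (etas phis : seq {poly F}) : bool :=
  sorted (fun p q : {poly F} => p %| q) etas &&
  sorted (fun p q : {poly F} => q %| p) phis.

Definition smith_mcmillan_mx m n (etas phis : seq {poly F}) :
    'M[ratfun F]_(m, n) :=
  \matrix_(i, j) if (i == j :> nat) && (i < size etas)%N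
                 then tofrac etas`_i / tofrac phis`_i else 0.

Definition invariant_rational_functions m n (R : 'M[ratfun F]_(m, n))
    (etas phis : seq {poly F}) : Prop :=
  [/\ size etas = \rank R /\ size phis = \rank R,
      irreducible_fractions etas phis, div_chains etas phis
    & exists U : 'M[{poly F}]_m, exists V : 'M[{poly F}]_n,
      [/\ U \in unitmx, V \in unitmx
        & poly_mx U *m R *m poly_mx V = smith_mcmillan_mx m n etas phis]].

(* The zero vector gets degree 0; it never belongs to a basis. *)
Definition vdeg k (v : 'cV[{poly F}]_k) : nat :=
  \max_(i < k) (size (v i ord0)).-1.

Definition poly_basis k (S : {vspace 'cV[ratfun F]_k})
    (B : seq 'cV[{poly F}]_k) : bool :=
  basis_of S [seq poly_mx v | v <- B].

Definition minimal_basis k (S : {vspace 'cV[ratfun F]_k})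
    (B : seq 'cV[{poly F}]_k) : Prop :=
  poly_basis S B /\
  forall B' : seq 'cV[{poly F}]_k, poly_basis S B' ->
    (\sum_(v <- B) vdeg v <= \sum_(v <- B') vdeg v)%N.

Definition minimal_indices k (S : {vspace 'cV[ratfun F]_k}) (c : seq nat) :
    Prop :=
  exists2 B, minimal_basis S B & c = sort geq [seq vdeg v | v <- B].

Definition column_minimal_indices m n (R : 'M[ratfun F]_(m, n)) : seq nat -> Prop :=
  minimal_indices (lker (linfun (fun y : 'cV[ratfun F]_n => R *m y))).

End Rational.

(* Main.v *)
Require Import Defs.
From mathcomp Require Import all_boot all_order all_algebra.
From mathcomp Require Import perm constructive_ereal ring zify.

Set Implicit Arguments.
Unset Strict Implicit.
Unset Printing Implicit Defensive.

Import Order.TTheory GRing.Theory Num.Theory.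

Local Open Scope ring_scope.

(** The statement splits into a condition on divisibility and a condition on
    the minimal indices, and the two are independent.

    Divisibility. Call [x] a divisor of [y] in [F(s)] when [y / x] is a
    polynomial, and let [delta_i = eta_i / phi_i]. For an invariant rational
    function, [q] divides [delta_i] exactly when [R - q Z] has rank less than
    [i] for some polynomial [Z] ([irf_approx], [irf_of_approx]): the [delta_i]
    behave like singular values, that is, like distances to the matrices of
    small rank. Deleting rows does not increase the rank, and adding [z] rows
    increases it by at most [z]; this gives both divisibility relations
    ([irf_interlacing]). Since the fractions are irreducible, a divisibility of
    fractions is one of numerators and a reverse one of denominators
    ([irf_dvdP]).
    Conversely, let [alpha_i] and [beta_i] be the invariant rational functions
    of [R] and those prescribed, with [alpha_i = beta_i p_i] and
    [beta_(i+z) = alpha_i t_i]. The row [p_i e_i + e_(i+z)] times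
    [diag(beta)] is [alpha_i e_i + beta_(i+z) e_(i+z)], which is
    [alpha_i (e_i + t_i e_(i+z))]. So these rows carry [diag(beta)] to
    [diag(alpha)] up to a unimodular matrix on the right, and together with
    [e_1, .., e_z] they form a unimodular matrix ([row_completion]).

    Minimal indices. The kernel of the completed matrix is a subspace [S'] of
    codimension [x] of the kernel [S] of [R]. By exchange, a polynomial vector
    of [S] only involves the vectors of a minimal basis whose degree does not
    exceed its own ([exchange]); counting dimensions in both directions yields
    the equalities of the indices beyond [h] ([nested_minimal_indices]).
    Conversely, from a minimal basis [g_1, g_2, ..] of [S], ordered by
    decreasing degrees [c_i], the vectors
    [s^(d_j - c_(j+x-1)) g_(j+x-1) + g_(j+x)] for the first indices [j],
    followed by the last vectors [g_(j+x)], span a subspace with minimal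
    indices [d]. This uses the characterization of minimal bases by saturation
    and predictable degrees ([minimal_saturated], [minimal_predictable],
    [minimal_of_predictable]).

    The two constructions combine because the new basis of [S] differs from
    the old one by a unimodular matrix, hence extends to a unimodular matrix
    that brings [R] to its Smith-McMillan form ([basis_completion]), and the
    row completion leaves the last columns of that matrix unchanged. *)


(** * Fractions of polynomials and integral closedness *)

Section Fractions.
Variable F : fieldType.
Local Notation K := (ratfun F).
Local Notation "p %:F" := (@tofrac {poly F} p).

Lemma frac_coprime (x : K) :
  exists a b, [/\ b != 0, coprimep a b & x = a%:F / b%:F].
Proof.
elim/quotW: x => y; have d0 := denom_ratioP y.
have Ey : (\pi_({fraction {poly F}}) y)%qT = (frac y).1%:F / (frac y).2%:F.
  apply: (canRL (mulfK _)); first by rewrite tofrac_eq0.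
  unlock tofrac; rewrite -[LHS]FracField.pi_mul; apply/eqmodP => /=.
  rewrite FracField.equivfE /FracField.mulf /=.
  rewrite !numden_Ratio ?mulf_neq0 ?oner_neq0 //.
  by rewrite !mulr1 mulrC.
rewrite Ey; move: (frac y).1 (frac y).2 d0 => n d d0.
have g0 : gcdp n d != 0 by rewrite gcdp_eq0 negb_and d0 orbT.
have En := divpK (dvdp_gcdl n d); have Ed := divpK (dvdp_gcdr n d).
exists (n %/ gcdp n d), (d %/ gcdp n d); split.
- by apply: contraNneq d0 => E; rewrite -Ed E mul0r.
- by rewrite coprimep_div_gcd // d0 orbT.
- have -> : n%:F = (n %/ gcdp n d)%:F * (gcdp n d)%:F by rewrite -tofracM En.
  have -> : d%:F = (d %/ gcdp n d)%:F * (gcdp n d)%:F by rewrite -tofracM Ed.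
  by rewrite -mulf_div divff ?mulr1 ?tofrac_eq0.
Qed.

(** The determinant is a polynomial in the entries, so it is compatible with
    congruence modulo [b]. *)
Lemma det_add_mulr (A : comNzRingType) n (M N : 'M[A]_n) b :
  exists p, \det (M + b *: N) = \det M + b * p.
Proof.
have cong_prod (s : 'S_n) : exists p,
    \prod_i (M + b *: N) i (s i) = \prod_i M i (s i) + b * p.
  apply: (big_ind2 (fun u v => exists p, u = v + b * p)).
  - by exists 0; rewrite mulr0 addr0.
  - move=> u1 u2 v1 v2 [p1 ->] [p2 ->]; exists (u2 * p2 + p1 * v2 + p1 * b * p2).
    ring.
  - by move=> i _; exists (N i (s i)); rewrite !mxE.
rewrite /determinant; apply: (big_ind2 (fun u v => exists p, u = v + b * p)).
- by exists 0; rewrite mulr0 addr0.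
- move=> u1 u2 v1 v2 [p1 ->] [p2 ->]; exists (p1 + p2).
  by rewrite mulrDr addrACA.
- move=> s _; have [p ->] := cong_prod s; exists ((-1) ^+ s * p).
  by rewrite mulrDr mulrCA.
Qed.

Lemma scalar_sub_scale (L : fieldType) n (q d a b : L) (M : 'M[L]_n) :
  q != 0 -> b != 0 -> d / q = a / b ->
  a%:M - b *: M = (b / q) *: (d%:M - q *: M).
Proof.
move=> q0 b0 E; rewrite scalerBr scalerA divfK // scale_scalar_mx.
by rewrite mulrAC -mulrA E mulrC divfK.
Qed.

(** If [d / q] were not a polynomial, it would be [a / b] in lowest terms, and
    the vanishing of [det (a - b Z)] modulo [b] makes [b] divide a power of
    [a]; this is the integral closedness of [F[s]] in matrix form. *)
Lemma dvd_of_singular n (q d : K) (Z : 'M[{poly F}]_n.+1) :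
  d != 0 -> \det (d%:M - q *: poly_mx Z) = 0 -> exists p, d = q * p%:F.
Proof.
move=> d0 det0; have q0 : q != 0.
  apply: contra_eq_neq det0 => ->; rewrite scale0r subr0 det_scalar.
  by rewrite expf_neq0.
have [a [b [b0 cab E]]] := frac_coprime (d / q).
have bK0 : b%:F != 0 by rewrite tofrac_eq0.
have Eab : poly_mx (a%:M - b *: Z) = (b%:F / q) *: (d%:M - q *: poly_mx Z).
  rewrite /poly_mx map_mxB map_mxZ map_scalar_mx.
  by rewrite (scalar_sub_scale _ q0 bK0 E).
have : \det (a%:M - b *: Z) = 0.
  apply/eqP; rewrite -tofrac_eq0 -det_map_mx -/(poly_mx _) Eab detZ det0.
  by rewrite mulr0.
have [p] := det_add_mulr a%:M (- Z) b; rewrite scalerN => -> /eqP.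
rewrite det_scalar addr_eq0 => /eqP Ep.
have ba : b %| a ^+ n.+1 by rewrite Ep -mulN1r dvdp_mull // dvdp_mulr.
have b1 : b %| 1.
  have cb : coprimep b (a ^+ n.+1) by rewrite coprimep_expr // coprimep_sym.
  by rewrite -(Gauss_dvdpl 1 cb) mul1r.
have [c Ec] : exists c, 1 = c * b by apply/dvdpP.
exists (a * c); rewrite -[LHS](divfK q0) E mulrC; congr (_ * _).
have -> : b%:F^-1 = c%:F; last by rewrite tofracM.
by apply: (mulIf bK0); rewrite mulVf // -tofracM -Ec tofrac1.
Qed.

End Fractions.

(** * Ranks of matrices over a field *)

Section Rank.
Variable L : fieldType.

Lemma rank_unit_mul m n (P : 'M[L]_m) (A : 'M_(m, n)) (Q : 'M_n) :
  P \in unitmx -> Q \in unitmx -> \rank (P *m A *m Q) = \rank A.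
Proof.
move=> uP uQ; rewrite mxrankMfree ?row_free_unit //.
by rewrite eqmxMfull // row_full_unit.
Qed.

Lemma rank_zero_rows m n i (A : 'M[L]_(m, n)) :
  (forall (a : 'I_m) b, (i <= a)%N -> A a b = 0) -> (\rank A <= i)%N.
Proof.
move=> A0; have [im|/ltnW mi] := leqP i m; last first.
  exact: leq_trans (rank_leq_row A) mi.
have -> : A = (pid_mx i : 'M_m) *m A.
  apply/matrixP => a b; rewrite mxE (bigD1 a) //= big1 => [|k ka].
    rewrite mxE eqxx /=; case: ltnP => [_|/A0->]; last by rewrite mulr0 addr0.
    by rewrite mul1r addr0.
  by rewrite mxE eq_sym -val_eqE /= in ka *; rewrite (negPf ka) mul0r.
by rewrite (leq_trans (mxrankM_maxl _ _)) // rank_pid_mx.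
Qed.

Lemma rank_mxsub m n k l (f : 'I_k -> 'I_m) (g : 'I_l -> 'I_n)
    (A : 'M[L]_(m, n)) :
  (\rank (mxsub f g A) <= \rank A)%N.
Proof.
have -> : mxsub f g A = rowsub f 1%:M *m A *m colsub g 1%:M.
  rewrite mul_rowsub_mx mul1mx mulmx_colsub mulmx1.
  by apply/matrixP => a b; rewrite !mxE.
by rewrite (leq_trans (mxrankM_maxl _ _)) // mxrankM_maxr.
Qed.

(** Row scaling turns a diagonal matrix minus [q Z] into a scalar matrix minus a
    matrix of the same kind, to which [dvd_of_singular] applies. *)
Lemma diag_mul_scalar n (d q : L) (e p : 'I_n -> L) (Z : 'M_n) :
  (forall j, d = e j * p j) ->
  diag_mx (\row_j p j) *m (diag_mx (\row_j e j) - q *: Z) =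
  d%:M - q *: (diag_mx (\row_j p j) *m Z).
Proof.
move=> E; rewrite mulmxBr -scalemxAr; congr (_ - _).
rewrite mul_diag_mx; apply/matrixP => a b; rewrite !mxE (E a).
by case: (a =P b) => [->|_]; rewrite ?mulr1n ?mulr0n ?mulr0 // mulrC.
Qed.

End Rank.

(** * Invariant rational functions and interlacing *)

Section Invariants.
Variable F : fieldType.
Local Notation K := (ratfun F).
Local Notation "p %:F" := (@tofrac {poly F} p).

(** Divisibility of fractions with a polynomial quotient, which extends that of
    polynomials. *)
Definition fdvd (x y : K) : Prop := exists p : {poly F}, y = x * p%:F.

Definition irf (eta phi : seq {poly F}) (i : nat) : K :=
  (eta`_i)%:F / (phi`_i)%:F.

(** With lowest terms on both sides, [a d p = b c] lets Gauss's lemma separate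
    the numerators from the denominators. *)
Lemma fdvdP (a b c d : {poly F}) :
  b != 0 -> d != 0 -> coprimep a b -> coprimep c d ->
  fdvd (a%:F / b%:F) (c%:F / d%:F) <-> (a %| c) && (d %| b).
Proof.
move=> b0 d0 cab ccd; split=> [[p E]|/andP[/dvdpP[u ->] /dvdpP[v Eb]]].
  have E' : c * b = a * p * d.
    apply/eqP; rewrite -tofrac_eq !tofracM.
    by rewrite -eqr_div ?tofrac_eq0 // E mulrAC.
  apply/andP; split.
    by rewrite -(Gauss_dvdpl c cab) E' -mulrA dvdp_mulr.
  have cdc : coprimep d c by rewrite coprimep_sym.
  by rewrite -(Gauss_dvdpr b cdc) E' dvdp_mull.
have v0 : v != 0 by apply: contraNneq b0 => v0; rewrite Eb v0 mul0r.
exists (u * v); rewrite mulrAC; apply/eqP.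
rewrite eqr_div ?tofrac_eq0 // -!tofracM tofrac_eq Eb; apply/eqP; ring.
Qed.

Lemma irreducible_fractions_nth (eta phi : seq {poly F}) i :
  irreducible_fractions eta phi -> (i < size eta)%N ->
  [/\ eta`_i \is monic, phi`_i \is monic & coprimep eta`_i phi`_i].
Proof.
case/and3P=> /all_nthP me /all_nthP mp; rewrite all2E.
case/andP=> /eqP sz /all_nthP cop ie.
split; [exact: me | by apply: mp; rewrite -sz|].
by have := cop (0, 0) i; rewrite size_zip -sz minnn nth_zip //; apply.
Qed.

Lemma irf_dvdP (eta phi eps psi : seq {poly F}) i j :
  irreducible_fractions eta phi -> irreducible_fractions eps psi ->
  (i < size eps)%N -> (j < size eta)%N ->
  fdvd (irf eps psi i) (irf eta phi j) <->
  (eps`_i %| eta`_j) && (phi`_j %| psi`_i).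
Proof.
move=> /irreducible_fractions_nth ih /irreducible_fractions_nth jh ie je.
have [_ /monic_neq0 p0 c1] := jh _ ie; have [_ /monic_neq0 p0' c2] := ih _ je.
exact: fdvdP.
Qed.

Lemma irf_neq0 (eta phi : seq {poly F}) i :
  irreducible_fractions eta phi -> (i < size eta)%N -> irf eta phi i != 0.
Proof.
move=> /irreducible_fractions_nth ih /ih[/monic_neq0 e0 /monic_neq0 p0 _].
by rewrite mulf_neq0 ?invr_eq0 ?tofrac_eq0.
Qed.

Lemma irf_chain (eta phi : seq {poly F}) i j :
  irreducible_fractions eta phi -> div_chains eta phi ->
  (i <= j < size eta)%N -> fdvd (irf eta phi i) (irf eta phi j).
Proof.
move=> irr /andP[se sp] /andP[ij je].
have sz : size eta = size phi.
  by case/and3P: irr => _ _; rewrite all2E => /andP[/eqP].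
have ie := leq_ltn_trans ij je.
have tr : transitive (fun p q : {poly F} => p %| q).
  by move=> p q u; apply: dvdp_trans.
have tr' : transitive (fun p q : {poly F} => q %| p).
  by move=> p q u pq qu; apply: dvdp_trans qu pq.
apply/irf_dvdP => //; apply/andP; split.
  exact: (sorted_leq_nth tr (@dvdpp _) 0 se).
by apply: (sorted_leq_nth tr' (@dvdpp _) 0 sp); rewrite ?inE -?sz.
Qed.

Lemma smith_mcmillanE m n (eta phi : seq {poly F}) (a : 'I_m) (b : 'I_n) :
  smith_mcmillan_mx m n eta phi a b = irf eta phi a *+ (a == b :> nat).
Proof.
rewrite mxE; case: eqP => //= _; case: ltnP => // le.
by rewrite /irf nth_default // tofrac0 mul0r.
Qed.

Lemma poly_mxM m n k (A : 'M[{poly F}]_(m, n)) (B : 'M_(n, k)) :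
  poly_mx (A *m B) = poly_mx A *m poly_mx B.
Proof. exact: map_mxM. Qed.

Lemma poly_mx1 n : poly_mx (1%:M : 'M[{poly F}]_n) = 1%:M.
Proof. exact: map_mx1. Qed.

Lemma poly_mx_unit n (A : 'M[{poly F}]_n) : A \in unitmx -> poly_mx A \in unitmx.
Proof.
move=> uA; have : poly_mx (invmx A) *m poly_mx A = 1%:M.
  by rewrite -poly_mxM mulVmx // poly_mx1.
by case/mulmx1_unit.
Qed.

(** The approximation is the truncation of the Smith-McMillan form to its first
    [i] diagonal entries; the chain condition makes the rest a polynomial
    multiple of the entry of index [i]. *)
Lemma irf_approx m n (R : 'M[K]_(m, n)) eta phi i :
  invariant_rational_functions R eta phi -> (i < size eta)%N ->
  exists Z, (\rank (R - irf eta phi i *: poly_mx Z)%R <= i)%N.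
Proof.
case=> [[_ _]] irr ch [U [V [uU uV E]]] ie.
have /fin_all_exists[p Ep] (a : 'I_m) : exists p : {poly F},
    (i <= a < size eta)%N -> irf eta phi a = irf eta phi i * p%:F.
  case: (boolP (i <= a < size eta)%N) => [h|_]; last by exists 0.
  by have [p Ep] := irf_chain irr ch h; exists p.
pose D : 'M[{poly F}]_(m, n) :=
  \matrix_(a, b) if (i <= a < size eta)%N && (a == b :> nat) then p a else 0.
exists (invmx U *m D *m invmx V).
rewrite -(rank_unit_mul _ (poly_mx_unit uU) (poly_mx_unit uV)).
rewrite mulmxBr mulmxBl E -scalemxAr -scalemxAl -!poly_mxM.
rewrite !mulmxA mulmxV // mul1mx -mulmxA mulVmx // mulmx1.
apply: rank_zero_rows => a b ia; rewrite mxE smith_mcmillanE !mxE.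
case: eqVneq => [_|_]; last first.
  by rewrite andbF tofrac0 mulr0 mulr0n subrr.
rewrite andbT; case: ifP => [/Ep->|]; first by rewrite mulr1n subrr.
rewrite ia /= => /negbT; rewrite -leqNgt => le.
by rewrite /irf nth_default // tofrac0 mul0r mulr0 mul0rn subrr.
Qed.

(** The leading square block of order [i + 1] of the reduced matrix is singular,
    and by the chain condition its rows can be rescaled so that the
    Smith-McMillan part becomes scalar. *)
Lemma irf_of_approx m n (R : 'M[K]_(m, n)) eta phi i q Z :
  invariant_rational_functions R eta phi -> (i < size eta)%N ->
  (\rank (R - q *: poly_mx Z)%R <= i)%N -> fdvd q (irf eta phi i).
Proof.
case=> [[sz _]] irr ch [U [V [uU uV E]]] ie rk.
have im : (i < m)%N by rewrite (leq_trans ie) // sz rank_leq_row.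
have jn : (i < n)%N by rewrite (leq_trans ie) // sz rank_leq_col.
pose Z1 := mxsub (widen_ord im) (widen_ord jn) (U *m Z *m V).
have /fin_all_exists[p Ep] (a : 'I_i.+1) : exists p : {poly F},
    irf eta phi i = irf eta phi a * p%:F.
  by apply: irf_chain; rewrite // ie andbT -ltnS.
have ES : mxsub (widen_ord im) (widen_ord jn)
    (poly_mx U *m (R - q *: poly_mx Z) *m poly_mx V) =
    diag_mx (\row_(a < i.+1) irf eta phi a) - q *: poly_mx Z1.
  rewrite mulmxBr mulmxBl E -scalemxAr -scalemxAl -!poly_mxM.
  by apply/matrixP => a b; rewrite [LHS]mxE [LHS]mxE smith_mcmillanE !mxE.
apply: (@dvd_of_singular _ i _ _ (diag_mx (\row_a p a) *m Z1)).
  exact: irf_neq0.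
have -> : poly_mx (diag_mx (\row_a p a) *m Z1) =
          diag_mx (\row_a (p a)%:F) *m poly_mx Z1.
  rewrite poly_mxM; congr (_ *m _); rewrite /poly_mx map_diag_mx.
  by congr diag_mx; apply/rowP => a; rewrite !mxE.
rewrite -(diag_mul_scalar _ _ Ep) -ES det_mulmx.
apply/eqP; rewrite mulf_eq0; apply/orP; right.
apply: contraTT rk; rewrite -unitfE -unitmxE -row_free_unit -ltnNge => /eqP rk1.
rewrite -(rank_unit_mul _ (poly_mx_unit uU) (poly_mx_unit uV)).
by rewrite -{1}[i.+1]rk1 rank_mxsub.
Qed.

(** The two interlacing relations are the behaviour of the distance to the
    matrices of small rank under deletion and addition of rows. *)
Lemma irf_interlacing m n z (R : 'M[K]_(m, n)) (W : 'M_(z, n)) eta phi eps psi :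
  invariant_rational_functions R eta phi ->
  invariant_rational_functions (col_mx R W) eps psi ->
  (forall i, (i < size eta)%N -> (i < size eps)%N ->
     fdvd (irf eps psi i) (irf eta phi i)) /\
  (forall i, (i < size eta)%N -> (i + z < size eps)%N ->
     fdvd (irf eta phi i) (irf eps psi (i + z))).
Proof.
move=> hR hM; split=> i ie ie'.
  have [Z rk] := irf_approx hM ie'.
  apply: (irf_of_approx (Z := usubmx Z) hR ie); apply: leq_trans rk.
  set d := irf _ _ _.
  have -> : R - d *: poly_mx (usubmx Z) = usubmx (col_mx R W - d *: poly_mx Z).
    by apply/matrixP => a b; rewrite [RHS]mxE [RHS]mxE col_mxEu !mxE.
  rewrite -[X in (_ <= \rank X)%N]vsubmxK; apply: mxrankS.
  by rewrite -addsmxE addsmxSl.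
have [Z rk] := irf_approx hR ie.
apply: (irf_of_approx (Z := col_mx Z 0) hM ie').
have -> : poly_mx (col_mx Z 0) = col_mx (poly_mx Z) 0 :> 'M_(m + z, n).
  by rewrite /poly_mx map_col_mx map_mx0.
rewrite scale_col_mx scaler0 opp_col_mx add_col_mx oppr0 addr0.
rewrite -addsmxE (leq_trans (mxrank_adds_leqif _ _)) // leq_add //.
exact: rank_leq_row.
Qed.

End Invariants.

(** * Minimal bases and the exchange property *)

Lemma sorted_geq_nth s i j :
  sorted geq s -> (i <= j < size s)%N -> (nth 0 s j <= nth 0 s i)%N.
Proof.
move=> srt /andP[ij js].
have geq_trans : transitive geq by move=> a b c ab bc; apply: leq_trans bc ab.
apply: (sorted_leq_nth geq_trans leqnn 0%N srt) => //.
by rewrite inE (leq_ltn_trans ij).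
Qed.

Section MinimalBases.
Variable F : fieldType.
Local Notation K := (ratfun F).

Lemma minimal_basis_perm k (S : {vspace 'cV[K]_k}) B B' :
  perm_eq B B' -> minimal_basis S B -> minimal_basis S B'.
Proof.
move=> pB [bB mB]; split=> [|B'' bB''].
  by rewrite /poly_basis -(perm_basis _ (perm_map _ pB)).
by rewrite -(perm_big _ pB) mB.
Qed.

Lemma minimal_indices_sorted k (S : {vspace 'cV[K]_k}) c :
  minimal_indices S c ->
  sorted geq c /\ exists2 B, minimal_basis S B & [seq vdeg v | v <- B] = c.
Proof.
case=> B mB ->; split.
  by apply: sort_sorted => a b; apply: leq_total.
exists (sort (relpre (@vdeg F k) geq) B); last by rewrite sort_map.
by apply: minimal_basis_perm mB; rewrite perm_sym perm_sort.
Qed.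

(** Otherwise replacing [b] by [v] would give a polynomial basis of smaller
    degree sum. *)
Lemma exchange k (S : {vspace 'cV[K]_k}) B b B' v :
  minimal_basis S B -> perm_eq B (b :: B') -> poly_mx v \in S ->
  poly_mx v \notin <<[seq poly_mx w | w <- B']>>%VS -> (vdeg b <= vdeg v)%N.
Proof.
move=> mB pB vS vB'; have [bB min] := minimal_basis_perm pB mB.
have bv : poly_basis S (v :: B').
  have /andP[/eqP spB frB] := bB.
  have dS : \dim S = (size B').+1 by rewrite -spB (eqP frB) /= size_map.
  rewrite /poly_basis basisEfree /= free_cons vB' dS /= size_map leqnn andbT.
  move: frB; rewrite /= free_cons => /andP[_ ->] /=.
  rewrite span_cons subv_add -memvE vS /= -spB /= span_cons.
  exact: addvSr.
by have := min _ bv; rewrite !big_cons leq_add2r.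
Qed.

(** The first [h] basis vectors are eliminated one after the other: by exchange
    each of them has a zero coefficient in [v]. *)
Lemma low_degree_span k (S : {vspace 'cV[K]_k}) B h v :
  minimal_basis S B -> (h <= size B)%N -> poly_mx v \in S ->
  (forall i, (i < h)%N -> (vdeg v < vdeg (nth 0%R B i))%N) ->
  poly_mx v \in <<[seq poly_mx w | w <- drop h B]>>%VS.
Proof.
move=> mB; have [bB _] := mB; have /andP[/eqP spB frB] := bB.
elim: h => [_ vS _|h IH hB vS low]; first by rewrite drop0 spB.
have := IH (ltnW hB) vS (fun i ih => low i (ltnW ih)).
rewrite (drop_nth 0 hB) /= span_cons => /memv_addP[_ /vlineP[a ->]] [w wB Ev].
case: (eqVneq a 0) Ev => [->|a0] Ev; first by rewrite Ev scale0r add0r.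
set b := nth 0 B h in Ev *.
have pB : perm_eq B (b :: (take h B ++ drop h.+1 B)).
  by rewrite -{1}(cat_take_drop h B) (drop_nth 0 hB) -cat1s perm_catCA.
have frb : poly_mx b \notin
    <<[seq poly_mx w | w <- take h B ++ drop h.+1 B]>>%VS.
  by move: frB; rewrite (perm_free (perm_map _ pB)) /= free_cons => /andP[].
have := low h (ltnSn h); rewrite -/b ltnNge => /negP[].
apply: (exchange mB pB vS); apply: contra frb => vB.
have -> : poly_mx b = a^-1 *: (poly_mx v - w).
  by rewrite Ev addrK scalerA mulVf // scale1r.
apply: memvZ; apply: memvB => //.
by move: wB; apply: subvP; rewrite map_cat span_cat addvSr.
Qed.

Lemma low_degree_subspace k (S : {vspace 'cV[K]_k}) B h
    (X : seq 'cV[{poly F}]_k) :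
  minimal_basis S B -> (h <= size B)%N ->
  free [seq poly_mx w | w <- X] ->
  (forall v, v \in X -> poly_mx v \in S) ->
  (forall v i, v \in X -> (i < h)%N -> (vdeg v < vdeg (nth 0%R B i))%N) ->
  (<<[seq poly_mx w | w <- X]>> <= <<[seq poly_mx w | w <- drop h B]>>)%VS /\
  (size X + h <= size B)%N.
Proof.
move=> mB hB frX XS low.
have sub : (<<[seq poly_mx w | w <- X]>> <=
            <<[seq poly_mx w | w <- drop h B]>>)%VS.
  apply/span_subvP => _ /mapP[v vX ->].
  by apply: (low_degree_span mB) => // [|i]; [exact: XS | exact: low].
split=> //; have := dimvS sub; rewrite (eqP frX) size_map => le.
have := leq_trans le (dim_span _); rewrite size_map size_drop => le'.
by rewrite -(subnK hB) leq_add2r.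
Qed.

(** The index [H] is the position where the degrees of [B'] fall below those of
    [B]. Two minimal bases of nested spaces constrain each other because the
    vectors of low degree of one lie in the span of the vectors of low degree
    of the other. Beyond [H] these spans coincide, so the comparison also runs
    from [B] to [B']. *)
Lemma nested_minimal_indices k (S S' : {vspace 'cV[K]_k}) B B' x :
  (S' <= S)%VS -> minimal_basis S B -> minimal_basis S' B' ->
  size B = (x + size B')%N ->
  sorted geq [seq vdeg v | v <- B] -> sorted geq [seq vdeg v | v <- B'] ->
  forall H, (forall i, (i < H + x)%N ->
    (vdeg (nth 0%R B' H) < vdeg (nth 0%R B i))%N) ->
  forall j, (H <= j < size B')%N ->
    vdeg (nth 0%R B' j) = vdeg (nth 0%R B (j + x)%N).
Proof.
move=> sS mB mB' szB srtB srtB' H hH j /andP[Hj jB'].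
have [bB _] := mB; have [bB' _] := mB'.
have decr (C : seq 'cV[{poly F}]_k) : sorted geq [seq vdeg v | v <- C] ->
    forall i v, v \in drop i C -> (vdeg v <= vdeg (nth 0%R C i))%N.
  move=> srt i v; have [ic|ci] := ltnP i (size C); last by rewrite drop_oversize.
  move=> /(nthP 0)[l]; rewrite size_drop nth_drop => lC <-.
  have lC' : (i + l < size C)%N by rewrite -ltn_subRL.
  have := @sorted_geq_nth _ i (i + l) srt; rewrite size_map !(nth_map 0) //.
  by apply; rewrite leq_addr.
have freedrop (T : {vspace 'cV[K]_k}) C i : poly_basis T C ->
    free [seq poly_mx w | w <- drop i C].
  move=> /basis_free; rewrite -{1}(cat_take_drop i C) map_cat.
  exact: catr_free.
have memT (T : {vspace 'cV[K]_k}) C v : poly_basis T C -> v \in C ->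
    poly_mx v \in T.
  by move=> bC vC; rewrite -(span_basis bC) memv_span // map_f.
have below (T T' : {vspace 'cV[K]_k}) C C' i l :
    (T' <= T)%VS -> minimal_basis T C -> minimal_basis T' C' ->
    sorted geq [seq vdeg v | v <- C'] -> (i <= size C)%N ->
    (forall a, (a < i)%N -> (vdeg (nth 0%R C' l) < vdeg (nth 0%R C a))%N) ->
    (<<[seq poly_mx w | w <- drop l C']>> <=
     <<[seq poly_mx w | w <- drop i C]>>)%VS /\ (size C' - l + i <= size C)%N.
  move=> sT mC [bC' _] srt iC lt; rewrite -size_drop.
  apply: (low_degree_subspace mC iC (freedrop _ _ _ bC')) => [v vD|v a vD ai].
    by apply: (subvP sT); apply: memT bC' (mem_drop vD).
  by apply: leq_ltn_trans (lt a ai); apply: decr.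
apply/eqP; rewrite eqn_leq; apply/andP; split; rewrite leqNgt; apply/negP => lt.
  have hHB : (H + x <= size B)%N.
    by rewrite szB [(H + x)%N]addnC leq_add2l (leq_trans Hj) // ltnW.
  have [subH _] := below _ _ _ _ _ H sS mB mB' srtB' hHB hH.
  have eqS : <<[seq poly_mx w | w <- drop H B']>>%VS =
             <<[seq poly_mx w | w <- drop (H + x) B]>>%VS.
    apply/eqP; rewrite eqEdim subH (eqP (freedrop _ _ H bB')).
    by rewrite (eqP (freedrop _ _ _ bB)) !size_map !size_drop szB
      [(x + _)%N]addnC subnDr /=.
  have mS'' v : v \in drop (j + x) B -> poly_mx v \in S'.
    move=> vD; have : poly_mx v \in <<[seq poly_mx w | w <- drop H B']>>%VS.
      rewrite eqS memv_span // map_f //; move: vD.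
      have -> : (j + x = (j - H) + (H + x))%N by rewrite addnA subnK.
      by rewrite -drop_drop => /mem_drop.
    apply: subvP; rewrite -(span_basis bB') -{2}(cat_take_drop H B') map_cat.
    by rewrite span_cat addvSr.
  have low v a : v \in drop (j + x) B -> (a < j.+1)%N ->
      (vdeg v < vdeg (nth 0%R B' a))%N.
    move=> /(decr _ srtB) le aj; apply: leq_ltn_trans le _; apply: leq_trans lt _.
    have := @sorted_geq_nth _ a j srtB'; rewrite size_map jB' andbT.
    by rewrite !(nth_map 0) ?(leq_ltn_trans _ jB') //; apply.
  have [_] := low_degree_subspace mB' jB' (freedrop _ _ _ bB) mS'' low.
  by rewrite size_drop szB [(j + x)%N]addnC subnDl addnS subnK ?ltnn // ltnW.
have jxB : (j + x < size B)%N by rewrite szB addnC ltn_add2l.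
have [|_] := below _ _ _ _ (j + x).+1 j sS mB mB' srtB' jxB.
  move=> a aj; apply: leq_trans lt _.
  have := @sorted_geq_nth _ a (j + x) srtB; rewrite size_map jxB andbT.
  by rewrite !(nth_map 0) ?(leq_ltn_trans _ jxB) //; apply.
by rewrite addnS addnA subnK 1?addnC -?szB ?ltnn // ltnW.
Qed.

End MinimalBases.

(** * Bases as matrices of columns *)

Lemma cols_basisP (L : fieldType) n k (S : {vspace 'cV[L]_n})
    (A : 'M[L]_(n, k)) :
  basis_of S [seq col j A | j <- enum 'I_k] <->
  (forall v, v \in S <-> exists a : 'cV_k, v = A *m a) /\
  (forall a : 'cV_k, A *m a = 0 -> a = 0).
Proof.
pose X := [tuple col j A | j < k].
have EX : [seq col j A | j <- enum 'I_k] = X by [].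
have mulE (a : 'cV_k) : A *m a = \sum_j a j 0 *: X`_j.
  apply/colP => i; rewrite mxE summxE; apply: eq_bigr => j _.
  by rewrite -tnth_nth tnth_mktuple !mxE mulrC.
have spanE v : v \in <<X>>%VS <-> exists a : 'cV_k, v = A *m a.
  split=> [/coord_span E|[a ->]].
    exists (\col_j coord X j v); rewrite mulE {1}E.
    by apply: eq_bigr => j _; rewrite mxE.
  rewrite mulE; apply: memv_suml => j _; apply/memvZ/memv_span.
  by rewrite -tnth_nth mem_tnth.
rewrite EX; split=> [/andP[/eqP spX /freeP frX]|[spS inj]].
  split=> [v|a]; first by rewrite -spX.
  by rewrite mulE => /frX a0; apply/colP => j; rewrite a0 mxE.
apply/andP; split.
  apply/eqP/vspaceP => v; apply/idP/idP => [/spanE/spS //|/spS/spanE //].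
apply/freeP => a a0 j; have /colP/(_ j) : \col_j a j = 0 :> 'cV_k.
  apply: inj; rewrite mulE -[RHS]a0; apply: eq_bigr => i _.
  by rewrite mxE.
by rewrite !mxE.
Qed.

Section ColumnBases.
Variable F : fieldType.
Local Notation K := (ratfun F).
Local Notation "p %:F" := (@tofrac {poly F} p).

Definition cols n k (G : 'M[{poly F}]_(n, k)) : seq 'cV[{poly F}]_n :=
  [seq col j G | j <- enum 'I_k].

Definition column_basis n k (S : {vspace 'cV[K]_n}) (G : 'M[{poly F}]_(n, k)) :=
  (forall v, v \in S <-> exists a : 'cV_k, v = poly_mx G *m a) /\
  (forall a : 'cV_k, poly_mx G *m a = 0 -> a = 0).

(** For independent columns this means that they generate all the polynomial
    vectors of the space that they span. *)
Definition saturated n k (G : 'M[{poly F}]_(n, k)) : Prop :=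
  forall (v : 'cV_n) (a : 'cV_k), poly_mx v = poly_mx G *m a ->
  exists p, a = poly_mx p.

(** No cancellation of leading terms occurs in a polynomial combination of the
    columns. Multiplying by ['X^d] instead of adding [d] to a degree makes the
    inequality hold for zero coefficients as well. *)
Definition predictable_degree n k (G : 'M[{poly F}]_(n, k)) : Prop :=
  forall (p : 'cV_k) i,
  (size (p i 0 * 'X^(vdeg (col i G)))%R <= (vdeg (G *m p)).+1)%N.

Lemma poly_mx_inj m n : injective (@poly_mx F m n).
Proof.
move=> A B /matrixP E; apply/matrixP => i j; have := E i j.
by rewrite !mxE => /eqP; rewrite tofrac_eq => /eqP.
Qed.

Lemma poly_basis_colsP n k (S : {vspace 'cV[K]_n}) (G : 'M[{poly F}]_(n, k)) :
  poly_basis S (cols G) <-> column_basis S G.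
Proof.
have E : [seq poly_mx v | v <- cols G] = [seq col j (poly_mx G) | j <- enum 'I_k].
  by rewrite -map_comp; apply: eq_map => j /=; rewrite /poly_mx map_col.
by rewrite /poly_basis E; apply: cols_basisP.
Qed.

Lemma nth_cols n k (G : 'M[{poly F}]_(n, k)) (j : 'I_k) : (cols G)`_j = col j G.
Proof. by rewrite (nth_map j) ?size_enum_ord // nth_ord_enum. Qed.

Lemma size_cols n k (G : 'M[{poly F}]_(n, k)) : size (cols G) = k.
Proof. by rewrite size_map size_enum_ord. Qed.

Lemma cols_of_seq n k (B : seq 'cV[{poly F}]_n) :
  size B = k -> exists G : 'M_(n, k), B = cols G.
Proof.
move=> <-; exists (\matrix_(i, j) (B`_j) i 0).
apply: (@eq_from_nth _ 0) => [|i iB]; first by rewrite size_cols.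
rewrite -[i]/(val (Ordinal iB)) nth_cols.
by apply/colP => u; rewrite !mxE.
Qed.

Lemma vdeg_leP n (v : 'cV[{poly F}]_n) d :
  reflect (forall i, size (v i 0%R) <= d.+1)%N (vdeg v <= d)%N.
Proof.
apply: (iffP (bigmax_leqP _ _ _)) => H i; have := H i; last first.
  by case: (size _).
by move/(_ isT); case: (size _).
Qed.

Lemma size_vdeg n (v : 'cV[{poly F}]_n) i : (size (v i 0%R) <= (vdeg v).+1)%N.
Proof. by move: i; apply/vdeg_leP. Qed.

End ColumnBases.

(** * Saturation of minimal bases *)

Section Predictable.
Variable F : fieldType.
Local Notation K := (ratfun F).
Local Notation "p %:F" := (@tofrac {poly F} p).

Lemma mulmx_cols (L : nzRingType) n k (A : 'M[L]_(n, k)) (a : 'cV[L]_k) u :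
  (A *m a) u 0 = \sum_j A u j * a j 0.
Proof. by rewrite mxE. Qed.

(** The exchange property in coordinates. The bound on the sizes, rather than on
    [vdeg v], also covers columns of degree 0, where it forces [v = 0]. *)
Lemma low_size_coord0 n k (S : {vspace 'cV[K]_n}) (G : 'M[{poly F}]_(n, k))
  (v : 'cV_n) (a : 'cV_k) i :
  minimal_basis S (cols G) -> poly_mx v = poly_mx G *m a ->
  (forall u, size (v u 0%R) <= vdeg (col i G))%N -> a i 0 = 0.
Proof.
move=> mG Ev low; have [/poly_basis_colsP[spG inj] _] := mG.
apply/eqP/idPn => ai0.
have v0 : poly_mx v != 0.
  by apply: contraNneq ai0 => v0; rewrite (inj a) ?mxE // -Ev.
have pB : perm_eq (cols G) (col i G :: [seq col j G | j <- rem i (enum 'I_k)]).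
  exact: (perm_map _ (perm_to_rem (mem_enum 'I_k i))).
have vS : poly_mx v \in S by apply/spG; exists a.
have le : (vdeg (col i G) <= vdeg v)%N.
  apply: (exchange mG pB vS).
  have [/basis_free] := minimal_basis_perm pB mG.
  rewrite /= free_cons => /andP[+ _] _; apply: contra => vB.
  have -> : poly_mx (col i G) =
      (a i 0)^-1 *: (poly_mx v - \sum_(j < k | j != i) a j 0 *: poly_mx (col j G)).
    apply: (canRL (scalerK _)) => //; apply: (canRL (addrK _)).
    rewrite Ev; apply/colP => u; rewrite mulmx_cols [RHS](bigD1 i) //=.
    rewrite !mxE summxE mulrC; congr (_ + _).
    by apply: eq_bigr => j _; rewrite !mxE mulrC.
  apply/memvZ/memvB => //; apply: memv_suml => j ji; apply/memvZ/memv_span.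
  apply/map_f/map_f; rewrite mem_rem_uniq ?enum_uniq // inE mem_enum andbT.
  exact: ji.
have [c0|c0] := posnP (vdeg (col i G)).
  case/negP: v0; apply/eqP/colP => u; rewrite !mxE.
  by have := low u; rewrite c0 leqn0 size_poly_eq0 => /eqP ->; rewrite tofrac0.
have : (vdeg v <= (vdeg (col i G)).-1)%N by apply/vdeg_leP => u; rewrite prednK.
by move/(leq_trans le); rewrite leqNgt prednK // leqnn.
Qed.

Lemma common_denom k (a : 'cV[K]_k) :
  exists q (N : 'cV[{poly F}]_k), q != 0 /\ q%:F *: a = poly_mx N.
Proof.
have /fin_all_exists2[f f0 Ef] i :
    exists2 nd : {poly F} * {poly F}, nd.2 != 0 & a i 0 * nd.2%:F = nd.1%:F.
  have [u [v [v0 _ ->]]] := frac_coprime (a i 0).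
  by exists (u, v) => //; rewrite divfK // tofrac_eq0.
exists (\prod_i (f i).2), (\col_i ((f i).1 * \prod_(j | j != i) (f j).2)); split.
  by apply/prodf_neq0.
apply/colP => i; rewrite !mxE (bigD1 i) //= !tofracM -Ef.
by rewrite mulrC !mulrA.
Qed.

(** Removing from [v] the polynomial parts of its coordinates leaves a
    polynomial vector with strictly proper coordinates, whose degree is below
    that of some basis vector it involves. *)
Lemma minimal_saturated n k (S : {vspace 'cV[K]_n}) (G : 'M[{poly F}]_(n, k)) :
  minimal_basis S (cols G) -> saturated G.
Proof.
move=> mG v a Ev; have [/poly_basis_colsP[spG inj] _] := mG.
have [q [N [q0 EN]]] := common_denom a.
have qK0 : q%:F != 0 by rewrite tofrac_eq0.
pose P : 'cV_k := \col_i (N i 0 %/ q); pose M : 'cV_k := \col_i (N i 0 %% q).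
have ENP : N = q *: P + M.
  by apply/colP => i; rewrite !mxE {1}(divp_eq (N i 0) q) mulrC.
pose w := v - G *m P.
have Ew : q *: w = G *m M.
  apply: poly_mx_inj; rewrite /poly_mx map_mxZ map_mxB -!/(poly_mx _) poly_mxM.
  rewrite Ev -mulmxBr scalemxAr scalerBr EN poly_mxM; congr (_ *m _).
  by rewrite ENP /poly_mx map_mxD map_mxZ addrC addKr.
have Ew' : poly_mx w = poly_mx G *m (q%:F^-1 *: poly_mx M).
  by rewrite -scalemxAr -poly_mxM -Ew /poly_mx map_mxZ scalerA mulVf // scale1r.
suff M0 : M = 0.
  exists P; apply: (scalerI qK0); rewrite EN ENP M0 addr0.
  by rewrite /poly_mx map_mxZ.
apply/colP => i0; rewrite [RHS]mxE; apply/eqP/idPn => Mi0.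
have [i Mi maxi] :=
  @arg_maxnP _ i0 (fun i => M i 0 != 0) (fun i => vdeg (col i G)) Mi0.
suff low u : (size (w u 0%R) <= vdeg (col i G))%N.
  have /eqP := low_size_coord0 mG Ew' low; apply/negP.
  rewrite mxE; apply: mulf_neq0 (invr_neq0 qK0) _.
  by rewrite [poly_mx M i 0]mxE tofrac_eq0.
clearbody w; have [->|wu0] := eqVneq (w u 0) 0; first by rewrite size_poly0.
have sq : (0 < size q)%N by rewrite size_poly_gt0.
have : size (q * w u 0)%R = (size q + size (w u 0)%R).-1 by rewrite size_mul.
have -> : q * w u 0 = \sum_j G u j * M j 0 by rewrite -mulmx_cols -Ew mxE.
move=> Esz.
have : (size (\sum_j G u j * M j 0)%R <= (vdeg (col i G) + size q).-1)%N.
  apply: leq_trans (size_sum _ _ _) _; apply/bigmax_leqP => j _.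
  have [->|Mj] := eqVneq (M j 0) 0; first by rewrite mulr0 size_poly0.
  apply: leq_trans (size_polyMleq _ _) _.
  have h1 := size_vdeg (col j G) u; rewrite mxE in h1.
  have /= h2 := maxi j Mj.
  have h3 : (size (M j 0)%R < size q)%N by rewrite mxE ltn_modp.
  have nat_bd g c c' m b :
      (g <= c'.+1 -> c' <= c -> m < b -> (g + m).-1 <= (c + b).-1)%N by lia.
  exact: nat_bd h1 h2 h3.
rewrite Esz.
have nat_bd b c d : (0 < b -> (b + c).-1 <= (d + b).-1 -> c <= d)%N by lia.
exact: nat_bd.
Qed.

End Predictable.

(** * Predictable degrees *)

Lemma coefM_top (A : nzRingType) (p q : {poly A}) a b :
  (size p <= a.+1)%N -> (size q <= b.+1)%N -> (p * q)`_(a + b) = p`_a * q`_b.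
Proof.
move=> sp sq; have ab : (a < (a + b).+1)%N by rewrite ltnS leq_addr.
rewrite coefM (bigD1 (Ordinal ab)) //= addKn big1 ?addr0 // => i.
rewrite -val_eqE /= neq_ltn => /orP[ia|ai].
  rewrite [q`_ _]nth_default ?mulr0 // (leq_trans sq) //.
  by rewrite ltn_subRL ltn_add2r.
by rewrite nth_default ?mul0r // (leq_trans sp).
Qed.

Section Predictable.
Variable F : fieldType.
Local Notation K := (ratfun F).
Local Notation "p %:F" := (@tofrac {poly F} p).

(** If the leading terms cancelled, the combination of the columns by these
    leading terms, divided by the largest possible power of ['X], would be a
    vector of degree smaller than that of a column which it involves. *)
Lemma minimal_predictable n k (S : {vspace 'cV[K]_n}) (G : 'M[{poly F}]_(n, k)) :
  minimal_basis S (cols G) -> predictable_degree G.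
Proof.
move=> mG p i0; rewrite leqNgt; apply/negP => lt0.
pose c i := vdeg (col i G); pose s i := size (p i 0 * 'X^(c i)).
have lt : ((vdeg (G *m p)).+1 < s i0)%N by [].
have [i _ maxi] := @arg_maxnP _ i0 xpredT s isT.
have [D ED] : exists D, s i = D.+1.
  by case: (s i) (maxi i0 isT) lt => [|D] //=; [case: (s i0) | exists D].
have ltD : (vdeg (G *m p) < D)%N.
  by rewrite -ltnS -ED; apply: leq_trans lt _; apply: maxi.
have size_s j : p j 0 != 0 -> s j = (size (p j 0%R) + c j)%N.
  by move=> pj; rewrite /s size_mulXn // addnC.
(* The coefficient of p_j that contributes to degree D: it is the leading
   coefficient when the product with column j reaches degree D, else 0. *)
pose l j := (p j 0)`_(D - c j).
have li : l i != 0.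
  have pi : p i 0 != 0.
    by apply: contra_eq_neq ED => p0; rewrite /s p0 mul0r size_poly0.
  rewrite /l; have -> : (D - c i = (size (p i 0%R)).-1)%N.
    have pos : (0 < size (p i 0%R))%N by rewrite size_poly_gt0.
    have aux a b d : (0 < a -> a + b = d.+1 -> d - b = a.-1)%N by lia.
    by apply: aux pos _; rewrite -size_s.
  by rewrite -/(lead_coef _) lead_coef_eq0.
have sp j : (size (p j 0%R) <= (D - c j).+1)%N /\ (p j 0 != 0 -> (c j <= D)%N).
  have [->|pj] := eqVneq (p j 0) 0; first by rewrite size_poly0.
  have := maxi j isT; rewrite /= ED (size_s _ pj) => le.
  have pos : (0 < size (p j 0%R))%N by rewrite size_poly_gt0.
  have aux a b d : (0 < a -> a + b <= d.+1 -> a <= (d - b).+1 /\ b <= d)%N by lia.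
  by have [] := aux _ _ _ pos le.
have [k0 lk maxk] := @arg_maxnP _ i (fun j => l j != 0) c li.
pose a : 'cV[{poly F}]_k := \col_j (l j *: 'X^(c k0 - c j)).
have : poly_mx a k0 0 = 0.
  apply: (low_size_coord0 (v := G *m a) mG); first by rewrite poly_mxM.
  move=> u; apply/leq_sizeP => j; rewrite leq_eqVlt => /predU1P[<-|lj].
    rewrite mulmx_cols coef_sum.
    have /leq_sizeP/(_ D ltD) := size_vdeg (G *m p) u.
    rewrite mulmx_cols coef_sum => E; rewrite -[RHS]E; apply: eq_bigr => b _.
    have gb := size_vdeg (col b G) u; rewrite mxE -/(c b) in gb.
    rewrite mxE.
    have [spb cb] := sp b.
    have [pb|pb] := eqVneq (p b 0) 0.
      by rewrite /l pb coef0 scale0r !mulr0 !coef0.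
    rewrite -[in RHS](subnKC (cb pb)) coefM_top // -/(l b).
    have [->|lb] := eqVneq (l b) 0; first by rewrite scale0r mulr0 coef0 mulr0.
    rewrite -[X in _`_X](subnKC (maxk b lb)) coefM_top ?size_scale ?size_polyXn //.
    by rewrite coefZ coefXn eqxx mulr1.
  apply/leq_sizeP: j lj; rewrite mulmx_cols.
  apply: leq_trans (size_sum _ _ _) _; apply/bigmax_leqP => b _; rewrite mxE.
  have [->|lb] := eqVneq (l b) 0; first by rewrite scale0r mulr0 size_poly0.
  have gb := size_vdeg (col b G) u; rewrite mxE -/(c b) in gb.
  apply: leq_trans (size_polyMleq _ _) _; rewrite size_scale // size_polyXn.
  have aux x y z : (x <= y.+1 -> y <= z -> (x + (z - y).+1).-1 <= z.+1)%N by lia.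
  exact: aux gb (maxk b lb).
apply/eqP; rewrite !mxE subnn expr0 tofrac_eq0 scale_poly_eq0 negb_or lk.
exact: oner_neq0.
Qed.

(** A comparison basis is [G *m P] with [P] square of nonzero determinant; a
    nonzero term of that determinant matches the columns of the two bases so
    that predictable degrees bound each column of [G]. *)
Lemma minimal_of_predictable n k (S : {vspace 'cV[K]_n}) (G : 'M[{poly F}]_(n, k)) :
  column_basis S G -> saturated G -> predictable_degree G ->
  minimal_basis S (cols G).
Proof.
move=> bG satG pdG; have [spG injG] := bG.
have pbG : poly_basis S (cols G) by apply/poly_basis_colsP.
split=> // B' pbB'.
have szB' : size B' = k.
  have /andP[/eqP sp1 fr1] := pbG; have /andP[/eqP sp2 fr2] := pbB'.
  move: fr1 fr2; rewrite /free sp1 sp2.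
  rewrite (size_map _ (cols G)) (size_map _ B') size_cols.
  by move=> /eqP -> /eqP.
have [B EB] := cols_of_seq szB'; move: pbB'; rewrite EB.
case/poly_basis_colsP => spB injB.
have /fin_all_exists[P EP] (j : 'I_k) :
    exists q : 'cV[{poly F}]_k, col j B = G *m q.
  have /spG[a Ea] : poly_mx (col j B) \in S.
    by apply/spB; exists (delta_mx j 0); rewrite -colE /poly_mx map_col.
  have [q Eq] := satG _ _ Ea; exists q; apply: poly_mx_inj.
  by rewrite poly_mxM -Eq.
pose M := \matrix_(i, j) P j i 0.
have EM : B = G *m M.
  apply/matrixP => i j; have /colP/(_ i) := EP j; rewrite !mxE => ->.
  by apply: eq_bigr => u _; rewrite mxE.
have detM : \det M != 0.
  apply/negP => /eqP d0; have : \det (poly_mx M)^T = 0.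
    by rewrite det_tr /poly_mx det_map_mx d0 rmorph0.
  move=> /eqP/det0P[v v0 vM].
  suff : v^T = 0 by move/eqP; rewrite trmx_eq0 (negPf v0).
  apply: injB; rewrite EM poly_mxM -mulmxA -[X in _ *m X]trmxK trmx_mul trmxK.
  rewrite vM.
  by rewrite trmx0 mulmx0.
have [s Hs] : exists s : 'S_k, forall i, M i (s i) != 0.
  case: (pickP (fun s : 'S_k => [forall i, M i (s i) != 0])) => [s /forallP Hs|no].
    by exists s.
  case/eqP: detM; apply: big1 => s _; have := no s; move/negbT/forallPn=> [i].
  by rewrite negbK => /eqP Mi; rewrite (bigD1 i) //= Mi mul0r mulr0.
rewrite /cols 2!big_map !big_enum.
rewrite [X in (_ <= X)%N](reindex_inj (@perm_inj _ s)) /=.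
apply: leq_sum => i _; have := pdG (P (s i)) i; rewrite -EP.
have Pi := Hs i; rewrite mxE in Pi; rewrite size_mulXn // => le.
rewrite -ltnS (leq_trans _ le) // -addn1 leq_add2l.
by rewrite size_poly_gt0.
Qed.

End Predictable.

(** * Kernels and unimodular matrices *)

Local Notation right_kernel R := (lker (linfun (fun y : 'cV[_]_ _ => R *m y))).

Section Adapted.
Variable F : fieldType.
Local Notation K := (ratfun F).
Local Notation "p %:F" := (@tofrac {poly F} p).

Lemma mem_ker m n (M : 'M[K]_(m, n)) v :
  (v \in right_kernel M) = (M *m v == 0).
Proof. by rewrite memv_ker lfunE. Qed.

Lemma poly_mx_row n k l (A : 'M[{poly F}]_(n, k)) (B : 'M_(n, l)) :
  poly_mx (row_mx A B) = row_mx (poly_mx A) (poly_mx B).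
Proof. exact: map_row_mx. Qed.

Lemma mul_row_col0 (L : nzRingType) n k l (A : 'M[L]_(n, k))
    (B : 'M_(n, l)) (a : 'cV_l) :
  B *m a = row_mx A B *m col_mx 0 a.
Proof. by rewrite mul_row_col mulmx0 add0r. Qed.

(** Applying the inverse of the unimodular matrix reads off the coordinates as
    polynomials. *)
Lemma unimodular_saturated k l (V1 : 'M[{poly F}]_(k + l, k))
    (V2 : 'M_(k + l, l)) :
  row_mx V1 V2 \in unitmx ->
  saturated V2 /\ (forall a : 'cV_l, poly_mx V2 *m a = 0 -> a = 0).
Proof.
move=> uV.
have inv (a : 'cV[K]_l) :
    poly_mx (invmx (row_mx V1 V2)) *m (poly_mx V2 *m a) = col_mx 0 a.
  rewrite (mul_row_col0 (poly_mx V1) (poly_mx V2)) -poly_mx_row.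
  rewrite mulmxA -poly_mxM mulVmx //.
  by rewrite poly_mx1 mul1mx.
split=> [v a Ev|a a0]; have := inv a.
  rewrite -Ev -poly_mxM => Ea; exists (dsubmx (invmx (row_mx V1 V2) *m v)).
  have := congr1 dsubmx Ea; rewrite col_mxKd => <-.
  by apply/colP => i; rewrite !mxE.
by rewrite a0 mulmx0 => /(congr1 dsubmx); rewrite col_mxKd linear0.
Qed.

(** The kernel of a Smith-McMillan form is spanned by the last unit vectors. The
    columns are matched by their numerical index, so that [n] can be split at
    [r] in several ways. *)
Lemma smith_kernel m n r l (M : 'M[K]_(m, n)) (U : 'M_m) (V : 'M_n)
    (G : 'M[{poly F}]_(n, l)) eta phi :
  irreducible_fractions eta phi -> size eta = r -> (r <= m)%N -> (r + l)%N = n ->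
  U \in unitmx -> V \in unitmx ->
  poly_mx U *m M *m poly_mx V = smith_mcmillan_mx m n eta phi ->
  (forall u (J : 'I_l) (j : 'I_n), j = (r + J)%N :> nat -> V u j = G u J) ->
  column_basis (right_kernel M) G /\ saturated G.
Proof.
move=> irr sz rm en; case: n / en M V G => M V G uU uV E EG.
have EV : V = row_mx (lsubmx V) G.
  rewrite -[LHS]hsubmxK; congr row_mx; apply/matrixP => u J.
  by rewrite mxE (EG u J).
have uV' := uV; rewrite EV in uV'; have [satG injG] := unimodular_saturated uV'.
split=> //; split=> // v; rewrite mem_ker; split=> [/eqP Mv|[a ->]].
  pose w := poly_mx (invmx V) *m v.
  have Ev : v = poly_mx V *m w.
    by rewrite mulmxA -poly_mxM mulmxV // poly_mx1 mul1mx.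
  clearbody w; have Sw : smith_mcmillan_mx m (r + l) eta phi *m w = 0.
    by rewrite -E -[LHS]mulmxA -Ev -mulmxA Mv mulmx0.
  have w0 : usubmx w = 0.
    apply/colP => i; have /colP/(_ (widen_ord rm i)) := Sw.
    rewrite !mxE (bigD1 (lshift l i)) //=.
    rewrite big1 => [|k ki]; rewrite smith_mcmillanE /=.
      have ie : (i < size eta)%N by rewrite sz.
      rewrite eqxx mulr1n addr0 => /eqP.
      by rewrite mulf_eq0 (negPf (irf_neq0 irr ie)) /= => /eqP.
    by rewrite -val_eqE eq_sym /= in ki; rewrite (negPf ki) mul0r.
  exists (dsubmx w); rewrite Ev EV poly_mx_row -[w]vsubmxK w0.
  by rewrite mul_row_col mulmx0 add0r col_mxKd.
rewrite (mul_row_col0 (poly_mx (lsubmx V)) (poly_mx G)) -poly_mx_row -EV.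
rewrite -(inj_eq (can_inj (mulKmx (poly_mx_unit uU)))) mulmx0 !mulmxA E.
apply/eqP/colP => i; rewrite !mxE big1 // => k _; rewrite smith_mcmillanE.
rewrite !mxE; case: splitP => [j _|j Ek]; first by rewrite mxE mulr0.
case: eqP => [ik|]; last by rewrite mul0r.
by rewrite /irf nth_default ?tofrac0 ?mul0r ?mul0rn ?mul0r // ik Ek sz leq_addr.
Qed.

(** The columns beyond the rank vanish, so any change of basis among them leaves
    the form unchanged. *)
Lemma smith_block_mul m r l (V1 : 'M[{poly F}]_(l, l)) eta phi :
  size eta = r ->
  smith_mcmillan_mx m (r + l) eta phi *m poly_mx (block_mx 1%:M 0 0 V1) =
  smith_mcmillan_mx m (r + l) eta phi.
Proof.
move=> sz; set A := smith_mcmillan_mx _ _ _ _.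
have rA : rsubmx A = 0.
  apply/matrixP => i j; rewrite mxE smith_mcmillanE mxE /=; case: eqP => // ->.
  by rewrite /irf nth_default ?tofrac0 ?mul0r ?mul0rn // sz leq_addr.
rewrite -[A]hsubmxK rA /poly_mx map_block_mx mul_row_block map_mx1 !map_mx0.
by rewrite mulmx1 !mulmx0 mul0mx !addr0.
Qed.

(** Two saturated bases of the same space generate the same module of polynomial
    vectors, hence differ by a unimodular matrix. *)
Lemma basis_completion m r l (R : 'M[K]_(m, r + l)) eta phi (G : 'M_(r + l, l)) :
  \rank R = r -> invariant_rational_functions R eta phi ->
  column_basis (right_kernel R) G ->
  saturated G ->
  exists U : 'M_m, exists V1 : 'M_(r + l, r),
  [/\ U \in unitmx, row_mx V1 G \in unitmx &
   poly_mx U *m R *m poly_mx (row_mx V1 G) = smith_mcmillan_mx m (r + l) eta phi].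
Proof.
move=> hr [[sz _] irr ch [U [V [uU uV E]]]] [spG injG] satG; rewrite hr in sz.
have rm : (r <= m)%N by rewrite -hr rank_leq_row.
have [[spV injV] satV] : column_basis (right_kernel R)
    (rsubmx V) /\ saturated (rsubmx V).
  apply: (smith_kernel irr sz rm erefl uU uV E) => u J j Ej.
  by rewrite mxE; congr (V u _); apply: val_inj.
have change (A B : 'M[{poly F}]_(r + l, l)) : saturated A ->
    column_basis (right_kernel R) A ->
    column_basis (right_kernel R) B ->
    exists M, B = A *m M.
  move=> satA [spA _] [spB _].
  have /fin_all_exists[P EP] (j : 'I_l) :
      exists q : 'cV[{poly F}]_l, col j B = A *m q.
    have /spA[a Ea] : poly_mx (col j B) \in
        (right_kernel R).
      by apply/spB; exists (delta_mx j 0); rewrite -colE /poly_mx map_col.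
    have [q Eq] := satA _ _ Ea; exists q; apply: poly_mx_inj.
    by rewrite poly_mxM -Eq.
  exists (\matrix_(i, j) P j i 0); apply/matrixP => i j.
  have /colP/(_ i) := EP j; rewrite !mxE => ->.
  by apply: eq_bigr => u _; rewrite mxE.
have [M EM] := change _ _ satV (conj spV injV) (conj spG injG).
have [N EN] := change _ _ satG (conj spG injG) (conj spV injV).
have MN : M *m N = 1%:M.
  apply: poly_mx_inj; apply/matrixP => i j.
  have : poly_mx (rsubmx V) *m (col j (poly_mx (M *m N) - poly_mx 1%:M)) = 0.
    by rewrite colE mulmxA mulmxBr -!poly_mxM mulmxA -EM -EN mulmx1 subrr mul0mx.
  by move/injV/colP/(_ i)/eqP; rewrite !mxE subr_eq0 => /eqP.
have [uM _] := mulmx1_unit MN.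
exists U, (lsubmx V); have EV : row_mx (lsubmx V) G = V *m block_mx 1%:M 0 0 M.
  by rewrite -{2}[V]hsubmxK mul_row_block mulmx1 !mulmx0 addr0 add0r -EM.
split=> //; rewrite EV.
  by rewrite unitmx_mul uV unitmxE det_ublock det1 mul1r -unitmxE.
by rewrite poly_mxM mulmxA E smith_block_mul.
Qed.

Lemma rank_smith m n (eta phi : seq {poly F}) :
  irreducible_fractions eta phi -> (size eta <= m)%N -> (size eta <= n)%N ->
  \rank (smith_mcmillan_mx m n eta phi : 'M[K]_(m, n)) = size eta.
Proof.
move=> irr rm rn.
pose D := \row_(i < m) if (i < size eta)%N then irf eta phi i else 1.
have -> : smith_mcmillan_mx m n eta phi = diag_mx D *m pid_mx (size eta) *m 1%:M.
  rewrite mulmx1 mul_diag_mx; apply/matrixP => i j; rewrite smith_mcmillanE !mxE.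
  case: eqP => [_|_] /=; last by rewrite mulr0.
  case: ltnP => [_|le]; rewrite ?mulr1 //.
  by rewrite mulr0 /irf nth_default // tofrac0 mul0r.
rewrite rank_unit_mul ?rank_pid_mx ?unitmx1 // unitmxE det_diag unitfE.
apply/prodf_neq0 => i _; rewrite mxE; case: ifP => [ie|_]; last exact: oner_neq0.
exact: irf_neq0.
Qed.

End Adapted.

(** * A subspace with prescribed minimal indices *)

Section Codimension.
Variable F : fieldType.

(** Column [j] of the new basis is [g_j], to which a multiple of [g_(j-1)] of
    degree [d (j - x)] is added when [x <= j < x + h]. The first [x] columns are
    kept only to make the matrix square. *)
Definition chain_mx (c d : nat -> nat) x l h : 'M[{poly F}]_(x + l) :=
  \matrix_(i, j) ((i == j)%:R +
    if [&& i.+1 == j :> nat, x <= j & j - x < h]%N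
    then 'X^(d (j - x)%N - c i) else 0).

Lemma chain_mx_unit c d x l h : chain_mx c d x l h \in unitmx.
Proof.
rewrite -unitmx_tr unitmxE det_trig; last first.
  apply/is_trig_mxP => i j ij; rewrite !mxE.
  by rewrite -val_eqE /= !gtn_eqF ?addr0 // ltnW.
by rewrite big1 ?unitr1 // => i _; rewrite !mxE eqxx gtn_eqF ?addr0.
Qed.

Variables (c d : nat -> nat) (n x l h : nat) (G : 'M[{poly F}]_(n, x + l)).
Hypothesis pdG : predictable_degree G.
Hypothesis cG : forall j, vdeg (col j G) = c j.
Hypothesis c_decr : forall i j, (i <= j < x + l)%N -> (c j <= c i)%N.
Hypothesis h0 : x = 0%N -> h = 0%N.
Hypothesis cd : forall j, (j < h)%N -> (c (x + j).-1 <= d j)%N.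
Hypothesis cd_eq : forall j, (h <= j < l)%N -> d j = c (x + j)%N.

Local Notation E := (G *m chain_mx c d x l h).

(** Each coordinate of index [j < x + h] is determined, from the row before it,
    by the coordinate of index [j - 1]; the powers of ['X] are chosen so that
    the degree bound is carried along by induction. *)
Lemma chain_mx_predictable (q : 'cV_(x + l)) (j : 'I_(x + l)) :
  (forall i : 'I_(x + l), (i < x)%N -> q i 0 = 0) -> (x <= j)%N ->
  (size (q j 0 * 'X^(d (j - x)%N))%R <= (vdeg (E *m q)).+1)%N.
Proof.
move=> q0; set D := vdeg _; pose p := chain_mx c d x l h *m q.
have Hp i : (size (p i 0 * 'X^(c i))%R <= D.+1)%N.
  by rewrite -cG /D -mulmxA; apply: pdG.
have pE (i : 'I_(x + l)) : p i 0 = q i 0 + \sum_(k < x + l)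
    (if [&& i.+1 == k :> nat, x <= k & k - x < h]%N
     then 'X^(d (k - x)%N - c i) else 0) * q k 0.
  rewrite /p mxE; under eq_bigr do rewrite mxE mulrDl.
  rewrite big_split /= (bigD1 i) //= eqxx mul1r big1 ?addr0 // => k ki.
  by rewrite eq_sym (negPf ki) mul0r.
case: j => j jxl /=; elim: j jxl => [|j IH] jxl xj.
  have [x0 hz] : x = 0%N /\ h = 0%N.
    by split; [|apply: h0]; apply/eqP; rewrite -leqn0.
  have := Hp (Ordinal jxl); rewrite pE big1 => [|k _]; last first.
    by rewrite hz ltn0 !andbF mul0r.
  have Ed : d (0 - x)%N = c 0%N.
    by rewrite cd_eq; [rewrite x0 | move: jxl; clear -x0 hz; lia].
  by rewrite addr0 Ed.
have [jh|hj] := ltnP (j.+1 - x) h; last first.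
  have := Hp (Ordinal jxl); rewrite pE big1 => [|k _]; last first.
    case: eqP => [/= Ek|]; last by rewrite mul0r.
    by rewrite -Ek subSn // [(_ < h)%N]ltnNge (leq_trans hj) // andbF mul0r.
  by rewrite addr0 cd_eq /= ?subnKC // hj /= ltn_subLR.
have jl : (j < x + l)%N by apply: ltnW.
have cdj : (c j <= d (j.+1 - x))%N by have := cd jh; rewrite subnKC.
have := Hp (Ordinal jl); rewrite pE (bigD1 (Ordinal jxl)) //=.
rewrite big1 => [|k]; last first.
  rewrite -val_eqE /= eq_sym => kj; rewrite (negPf kj) /=.
  by rewrite mul0r.
rewrite eqxx xj jh addr0 /= mulrDl mulrAC -exprD subnK // => le.
rewrite mulrC -['X^_ * _](addKr (q (Ordinal jl) 0 * 'X^(c j))).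
apply: leq_trans (size_polyD _ _) _; rewrite geq_max size_polyN le andbT.
have [xj'|jx] := leqP x j; last by rewrite q0 ?mul0r ?size_poly0.
apply: leq_trans (IH jl xj'); have [->|qj] := eqVneq (q (Ordinal jl) 0) 0.
  by rewrite !mul0r size_poly0.
rewrite !size_mulXn // leq_add2r.
have jh' : (j - x < h)%N by apply: leq_ltn_trans jh; rewrite leq_sub2r.
apply: leq_trans (cd jh'); rewrite subnKC //; apply: c_decr.
by rewrite leq_pred jl.
Qed.

Lemma chain_mx_degree (J : 'I_l) : vdeg (col J (rsubmx E)) = d J.
Proof.
pose j := rshift x J.
have Ecol : col J (rsubmx E) = E *m delta_mx j 0.
  by rewrite -colE; apply/colP => u; rewrite !mxE.
apply/eqP; rewrite eqn_leq; apply/andP; split; last first.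
  have := @chain_mx_predictable (delta_mx j 0) j; rewrite -Ecol mxE !eqxx mul1r.
  rewrite size_polyXn /= addKn; apply; last exact: leq_addr.
  by move=> i ix; rewrite mxE -val_eqE /= ltn_eqF // ltn_addr.
apply/vdeg_leP => u; rewrite mxE mxE mxE.
apply: leq_trans (size_sum _ _ _) _; apply/bigmax_leqP => i _.
have gi := size_vdeg (col i G) u; rewrite mxE cG in gi.
rewrite mxE -val_eqE /=; case: eqP => [ij|_].
  rewrite ij gtn_eqF // addr0 mulr1; apply: leq_trans gi _; rewrite ltnS ij.
  have [Jh|hJ] := ltnP J h; last by rewrite cd_eq // hJ ltn_ord.
  by apply: leq_trans (cd Jh); apply: c_decr; rewrite leq_pred ltn_add2l ltn_ord.
rewrite add0r; case: ifP; last by rewrite mulr0 size_poly0.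
move=> /and3P[/eqP ij _ Jh].
rewrite addKn in Jh *; have := cd Jh; rewrite -ij /= => cdi.
apply: leq_trans (size_polyMleq _ _) _; rewrite size_polyXn.
have aux a b e : (a <= b.+1 -> b <= e -> (a + (e - b).+1).-1 <= e.+1)%N by lia.
exact: aux gi cdi.
Qed.

End Codimension.

(** * Completion of a Smith-McMillan form by rows *)

Section RowCompletion.
Variable F : fieldType.
Local Notation K := (ratfun F).
Local Notation "p %:F" := (@tofrac {poly F} p).

(** Moving the last [z] rows to the top makes the matrix lower unitriangular. *)
Lemma bidiagonal_unit m z (p : 'I_m -> {poly F}) :
  (z = 0%N -> forall i, p i = 0) ->
  col_mx (\matrix_(i < m, k < m + z)
            (p i *+ (k == i :> nat) + (k == (i + z)%N :> nat)%:R))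
         (\matrix_(i < z, k < m + z) (k == i :> nat)%:R) \in unitmx.
Proof.
move=> p0; set C := col_mx _ _.
have fP (i : 'I_(m + z)) : ~~ (i < z)%N -> (i - z < m)%N.
  by case: i => i /=; lia.
have aux1 a b k : (k < a -> a + b = k -> False)%N by lia.
have aux2 a b k : (~~ (a < k) -> ~~ (b < k) -> a - k = b - k -> a = b)%N by lia.
have aux3 a b : (0 < b -> ~~ (a < b) -> (a == a - b) = false)%N by lia.
pose f (i : 'I_(m + z)) : 'I_(m + z) :=
  match boolP (i < z)%N with
  | AltTrue iz => rshift m (Ordinal iz)
  | AltFalse iz => lshift z (Ordinal (fP i iz))
  end.
have finj : injective f.
  move=> i j; rewrite /f; case: {-}_ / boolP => iz; case: {-}_ / boolP => jz.
  - by move/rshift_inj/(congr1 val) => /= ?; apply: val_inj.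
  - by move/(congr1 val) => /= /(aux1 _ _ _ (fP j jz)).
  - by move/(congr1 val) => /= /esym/(aux1 _ _ _ (fP i iz)).
  - by move/lshift_inj/(congr1 val) => /= /(aux2 _ _ _ iz jz)/val_inj.
suff: row_perm (perm finj) C \in unitmx.
  by rewrite row_permE unitmx_mul => /andP[].
have rowE i k : row_perm (perm finj) C i k =
    (if boolP (i < z)%N is AltFalse iz
     then p (Ordinal (fP i iz)) *+ (k == (i - z)%N :> nat)
     else 0) + (k == i :> nat)%:R.
  rewrite mxE permE /f; case: {-}_ / boolP => iz.
    by rewrite col_mxEd mxE add0r.
  by rewrite col_mxEu mxE /= subnK // leqNgt.
rewrite unitmxE det_trig.
  rewrite big1 ?unitr1 // => i _; rewrite rowE eqxx.
  case: {-}_ / boolP => iz; first by rewrite add0r.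
  have [z0|z0] := posnP z; first by rewrite p0 // mul0rn add0r.
  by rewrite (aux3 _ _ z0 iz) mulr0n add0r.
apply/is_trig_mxP => i k ik; rewrite rowE (gtn_eqF ik) mulr0n addr0.
case: {-}_ / boolP => // iz; rewrite gtn_eqF ?mulr0n //.
exact: leq_ltn_trans (leq_subr _ _) ik.
Qed.

(** For [z > 0] the rows [p_i e_i + e_(i+z)] multiply the target form into the
    given one times the unitriangular matrix with rows [e_i + t_i e_(i+z)]. For
    [z = 0] both shifts would meet the diagonal, so [p] and [t] are set to 0 and
    the two forms are equal. By the last clause, [T] fixes the unit vectors that
    span the kernel of the target form. *)
Lemma row_completion m n z (eta phi eps psi : seq {poly F}) :
  irreducible_fractions eta phi ->
  (size eta <= m)%N -> (size eps <= size eta + z)%N ->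
  (z = 0%N -> forall i, irf eta phi i = irf eps psi i) ->
  (forall i, (i < size eta)%N -> (i < size eps)%N ->
     fdvd (irf eps psi i) (irf eta phi i)) ->
  (forall i, (i < size eta)%N -> (i + z < size eps)%N ->
     fdvd (irf eta phi i) (irf eps psi (i + z))) ->
  (size eta <= size eps)%N ->
  exists U : 'M_(m + z), exists T : 'M_n, exists W : 'M_(z, n),
  [/\ U \in unitmx, T \in unitmx,
     poly_mx U *m col_mx (smith_mcmillan_mx m n eta phi) W *m poly_mx T =
     smith_mcmillan_mx (m + z) n eps psi
   & forall i j : 'I_n, (size eps <= j)%N -> T i j = (i == j)%:R].
Proof.
move=> irr em ez hz hp ht ee.
have out (s t : seq {poly F}) i : (size s <= i)%N -> irf s t i = 0.
  by move=> si; rewrite /irf nth_default // tofrac0 mul0r.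
have /fin_all_exists[p Ep] (i : 'I_m) : exists p : {poly F},
    if (z == 0)%N then p = 0 else irf eta phi i = irf eps psi i * p%:F.
  case: eqP => [_|_]; first by exists 0.
  have [ie|ei] := ltnP i (size eta); first exact: hp (leq_trans ie ee).
  by exists 0; rewrite out // tofrac0 mulr0.
have /fin_all_exists[t Et] (i : 'I_n) : exists t : {poly F},
    [/\ (z == 0)%N -> t = 0, (size eps <= i + z)%N -> t = 0 &
     z != 0%N -> irf eps psi (i + z) = irf eta phi i * t%:F].
  case: eqP => [z0|_]; first by exists 0.
  have [ie|ei] := ltnP (i + z) (size eps); last first.
    by exists 0; split=> // _; rewrite out // tofrac0 mulr0.
  have [|t Et] := ht i _ ie; last by exists t.
  by rewrite -(ltn_add2r z) (leq_trans ie).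
pose P : 'M[{poly F}]_(m, m + z) :=
  \matrix_(i, k) (p i *+ (k == i :> nat) + (k == (i + z)%N :> nat)%:R).
pose Q : 'M[{poly F}]_(z, m + z) := \matrix_(i, k) (k == i :> nat)%:R.
pose T : 'M[{poly F}]_n :=
  \matrix_(i, j) ((i == j)%:R + t i *+ (j == (i + z)%N :> nat)).
pose A := smith_mcmillan_mx m n eta phi.
pose B := smith_mcmillan_mx (m + z) n eps psi.
have uC : col_mx P Q \in unitmx.
  apply: bidiagonal_unit => /eqP z0 i; have := Ep i.
  by rewrite z0.
have uT : T \in unitmx.
  rewrite -unitmx_tr unitmxE det_trig.
    rewrite big1 ?unitr1 // => i _; rewrite !mxE eqxx.
    have [t0 _ _] := Et i; have [z0|z0] := eqVneq z 0%N.
      by rewrite t0 ?z0 // mul0rn addr0.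
    by rewrite -[X in X == _]addn0 eqn_add2l eq_sym (negPf z0) mulr0n addr0.
  apply/is_trig_mxP => i j ij; rewrite !mxE -val_eqE /= gtn_eqF // add0r.
  by rewrite ltn_eqF ?mulr0n // ltn_addr.
have AT : A *m poly_mx T = poly_mx P *m B.
  apply/matrixP => i j; rewrite !mxE.
  have [jm|mj] := ltnP j (m + z); last first.
    rewrite [RHS]big1 => [|k _]; last first.
      rewrite smith_mcmillanE ltn_eqF ?mulr0 //.
      exact: leq_trans (ltn_ord k) mj.
    apply: big1 => k _; rewrite smith_mcmillanE.
    case: eqP => [ik|_]; last by rewrite mul0r.
    have kj : (k + z < j)%N by rewrite -ik (leq_trans _ mj) // ltn_add2r.
    rewrite !mxE -val_eqE /= ltn_eqF ?(leq_ltn_trans (leq_addr z k)) //.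
    by rewrite gtn_eqF // mulr0n addr0 tofrac0 mulr0.
  rewrite [RHS](bigD1 (Ordinal jm)) //= [X in _ = _ + X]big1 => [|k kj]; last first.
    by rewrite smith_mcmillanE -val_eqE /= in kj *; rewrite (negPf kj) mulr0.
  rewrite smith_mcmillanE eqxx mulr1n addr0 mxE [P i _]mxE /=.
  have [inn|ni] := ltnP i n; last first.
    rewrite big1 => [|k _]; last first.
      by rewrite smith_mcmillanE gtn_eqF ?mul0r // (leq_trans (ltn_ord k)).
    have ji : (j < i)%N by apply: leq_trans ni.
    rewrite ltn_eqF // ltn_eqF ?mulr0n ?addr0 ?tofrac0 ?mul0r //.
    exact: leq_trans ji (leq_addr _ _).
  rewrite (bigD1 (Ordinal inn)) //= big1 => [|k ki]; last first.
    have ki' : (i == k :> nat) = false by rewrite eq_sym; apply: negbTE ki.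
    by rewrite smith_mcmillanE ki' mul0r.
  rewrite addr0 smith_mcmillanE eqxx mulr1n mxE [T _ _]mxE -val_eqE /=.
  have := Ep i; have [t0 _ tz] := Et (Ordinal inn).
  have [z0 p0|z0 pz] := eqVneq z 0%N.
    rewrite p0 t0 ?z0 // !mul0rn addn0 addr0 add0r mulrC eq_sym.
    case: eqP => [->|_]; last by rewrite !tofrac0 !mul0r.
    by rewrite hz.
  have := tz z0; rewrite /= => tz'.
  have iz : (i == (i + z)%N :> nat) = false.
    by rewrite -[X in X == _]addn0 eqn_add2l eq_sym (negPf z0).
  have [-> | ij] := eqVneq (j : nat) i.
    by rewrite iz !mulr0n !mulr1n !addr0 tofrac1 mulr1 pz mulrC.
  rewrite !mulr0n !add0r; case: eqP => [->|_].
    by rewrite mulr1n tofrac1 mul1r tz'.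
  by rewrite !mulr0n !tofrac0 mulr0 mul0r.
exists (invmx (col_mx P Q)), T, (poly_mx Q *m B *m poly_mx (invmx T)).
split=> //; first by rewrite unitmx_inv.
  have -> : col_mx A (poly_mx Q *m B *m poly_mx (invmx T)) =
     poly_mx (col_mx P Q) *m B *m poly_mx (invmx T).
    have -> : A = poly_mx P *m B *m poly_mx (invmx T).
      by rewrite -AT -mulmxA -poly_mxM mulmxV // poly_mx1 mulmx1.
    by rewrite /poly_mx map_col_mx !mul_col_mx.
  rewrite !mulmxA -poly_mxM mulVmx // poly_mx1 mul1mx -mulmxA -poly_mxM mulVmx //.
  by rewrite poly_mx1 mulmx1.
move=> i j ej; rewrite mxE; have [_ t0 _] := Et i.
case: (_ =P (i + z)%N) => [Ej|_]; last by rewrite mulr0n addr0.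
by rewrite t0 -?Ej // mul0rn addr0.
Qed.

End RowCompletion.

(** * Completion with prescribed invariants *)

Section Main.
Variable F : fieldType.
Local Notation K := (ratfun F).

(** The vectors of the new kernel basis are the last [l] columns of [V], which
    the column operation [T] of the row completion fixes. *)
Lemma completion_exists m n r x l z (R : 'M[K]_(m, n))
    (eta phi eps psi : seq {poly F}) (c d : seq nat) h :
  (r + (x + l))%N = n -> \rank R = r ->
  invariant_rational_functions R eta phi ->
  column_minimal_indices R c -> size c = (x + l)%N ->
  irreducible_fractions eps psi -> div_chains eps psi ->
  size eps = (r + x)%N -> size psi = (r + x)%N ->
  sorted geq d -> size d = l -> (x <= z)%N ->
  (x = 0%N -> h = 0%N) ->
  (forall j, (j < h)%N -> (nth 0 c (x + j).-1 <= nth 0 d j)%N) ->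
  (forall j, (h <= j < l)%N -> nth 0%N d j = nth 0%N c (x + j)) ->
  (forall i, (i < r)%N -> fdvd (irf eps psi i) (irf eta phi i)) ->
  (forall i, (i < r)%N -> (i + z < r + x)%N ->
     fdvd (irf eta phi i) (irf eps psi (i + z))) ->
  exists W : 'M_(z, n),
  [/\ \rank (col_mx R W) = (r + x)%N,
      invariant_rational_functions (col_mx R W) eps psi
    & column_minimal_indices (col_mx R W) d].
Proof.
move=> en hr hR /minimal_indices_sorted[c_srt [B mB Bc]] szc irr ch sze szp.
move=> d_srt szd xz h0 cd cd_eq hp ht.
case: n / en R hr hR B mB Bc => R hr hR B mB Bc.
have [[szeta _] irr' ch' _] := hR; rewrite hr in szeta.
have rm : (r <= m)%N by rewrite -hr rank_leq_row.
have [|G EB] := @cols_of_seq _ _ (x + l)%N B.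
  by have := congr1 size Bc; rewrite size_map szc.
rewrite {}EB in mB Bc.
have satG := minimal_saturated mB; have pdG := minimal_predictable mB.
have [/poly_basis_colsP bG _] := mB.
have cG j : vdeg (col j G) = nth 0%N c j.
  by rewrite -Bc (nth_map 0) ?size_cols // nth_cols.
have c_decr i j : (i <= j < x + l)%N -> (nth 0 c j <= nth 0 c i)%N.
  by rewrite -szc; apply: sorted_geq_nth.
have [U [V1 [uU uV E]]] := basis_completion hr hR bG satG.
pose Kh := chain_mx F (nth 0%N c) (nth 0%N d) x l h.
pose E' := G *m Kh; pose V := row_mx V1 E'.
have EV : V = row_mx V1 G *m block_mx 1%:M 0 0 Kh.
  by rewrite mul_row_block mulmx1 !mulmx0 addr0 add0r.
have uV' : V \in unitmx.
  rewrite EV unitmx_mul uV unitmxE det_ublock det1 mul1r -unitmxE.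
  exact: chain_mx_unit.
have EA : poly_mx U *m R *m poly_mx V = smith_mcmillan_mx m (r + (x + l)) eta phi.
  by rewrite EV poly_mxM mulmxA E smith_block_mul.
have hz : z = 0%N -> forall i, irf eta phi i = irf eps psi i.
  move=> z0 i; have x0 : x = 0%N by apply/eqP; rewrite -leqn0 -z0.
  have [ir|ri] := ltnP i r; last first.
    rewrite /irf [eta`_i]nth_default ?szeta //.
    rewrite [eps`_i]nth_default ?sze ?x0 ?addn0 //.
    by rewrite tofrac0 !mul0r.
  have ie : (i < size eps)%N by rewrite sze x0 addn0.
  have ie' : (i < size eta)%N by rewrite szeta.
  have /(irf_dvdP irr' irr ie ie')/andP[d1 d2] := hp i ir.
  have : fdvd (irf eta phi i) (irf eps psi i).
    by have := ht i ir; rewrite z0 x0 !addn0; apply.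
  move/(irf_dvdP irr irr' ie' ie)/andP=> [d3 d4].
  have [m1 m2 _] := irreducible_fractions_nth irr' ie'.
  have [m3 m4 _] := irreducible_fractions_nth irr ie.
  have /eqP E1 : eta`_i == eps`_i by rewrite -eqp_monic // /eqp d1 d3.
  have /eqP E2 : phi`_i == psi`_i by rewrite -eqp_monic // /eqp d2 d4.
  by rewrite /irf E1 E2.
have em : (size eta <= m)%N by rewrite szeta.
have ez : (size eps <= size eta + z)%N by rewrite sze szeta leq_add2l.
have ee : (size eta <= size eps)%N by rewrite szeta sze leq_addr.
rewrite -szeta in hp; rewrite -sze -szeta in ht.
have [U2 [T [W0 [uU2 uT EB lastT]]]] :=
  row_completion (r + (x + l)) irr' em ez hz (fun i ie _ => hp i ie) ht ee.
pose W := W0 *m poly_mx (invmx V); exists W.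
pose U' := U2 *m block_mx U 0 0 1%:M.
have uU' : U' \in unitmx.
  by rewrite unitmx_mul uU2 unitmxE det_ublock det1 mulr1 -unitmxE.
have uVT : V *m T \in unitmx by rewrite unitmx_mul uV' uT.
have ES : poly_mx U' *m col_mx R W *m poly_mx (V *m T) =
    smith_mcmillan_mx (m + z) (r + (x + l)) eps psi.
  rewrite -EB !poly_mxM -!mulmxA; congr (_ *m _); rewrite !mulmxA; congr (_ *m _).
  rewrite /poly_mx map_block_mx !map_mx0 map_mx1 -!/(poly_mx _) mul_block_col.
  rewrite !mul0mx addr0 add0r mul1mx mul_col_mx EA; congr col_mx.
  by rewrite -mulmxA -poly_mxM mulVmx // poly_mx1 mulmx1.
have rkS : \rank (col_mx R W) = (r + x)%N.
  rewrite -(rank_unit_mul _ (poly_mx_unit uU') (poly_mx_unit uVT)) ES.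
  rewrite rank_smith ?sze //.
    by rewrite leq_add.
  by rewrite leq_add2l leq_addr.
split=> //.
  split=> //; first by rewrite rkS sze szp.
  by exists U', (V *m T).
pose G' := rsubmx E'.
have [bG' satG'] : column_basis (right_kernel (col_mx R W)) G' /\ saturated G'.
  apply: (smith_kernel irr sze _ (esym (addnA _ _ _)) uU' uVT ES).
    by rewrite leq_add.
  move=> u J j Ej; rewrite mxE (bigD1 j) //= big1 => [|k kj]; last first.
    by rewrite lastT ?sze ?Ej ?leq_addr // (negPf kj) mulr0.
  rewrite lastT ?sze ?Ej ?leq_addr // eqxx mulr1 addr0.
  have -> : j = rshift r (rshift x J) by apply: val_inj; rewrite /= Ej addnA.
  by rewrite /V row_mxEr [RHS]mxE.
have degG' (J : 'I_l) : vdeg (col J G') = nth 0%N d J.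
  exact: chain_mx_degree.
have pdG' : predictable_degree G'.
  move=> q J; rewrite degG' (mul_row_col0 (lsubmx E') G') hsubmxK.
  have := @chain_mx_predictable F (nth 0%N c) (nth 0%N d) _ x l h G
    pdG cG c_decr h0 cd cd_eq (col_mx 0 q) (rshift x J).
  rewrite col_mxEd /= addKn; apply; last exact: leq_addr.
  move=> i ix; rewrite mxE; case: splitP => [k _|k Ek]; rewrite ?mxE //.
  by rewrite Ek ltnNge leq_addr in ix *.
exists (cols G'); first exact: minimal_of_predictable.
have -> : [seq vdeg v | v <- cols G'] = d.
  apply: (@eq_from_nth _ 0%N) => [|i]; rewrite size_map size_cols // => il.
  by rewrite (nth_map 0) ?size_cols // -[i]/(val (Ordinal il)) nth_cols degG'.
by rewrite sorted_sort // => a b e ab be; apply: leq_trans be ab.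
Qed.
End Main.

(** * Indices and the theorem *)

Lemma ext_pos (T : Type) (lo hi : T) (s : seq T) (a : nat) :
  ext lo hi s a.+1%:Z = nth hi s a.
Proof. by rewrite /ext (_ : a.+1%:Z - 1 = a%:Z) //; lia. Qed.

Lemma int_pos_nat (i : int) : 1 <= i -> exists a : nat, i = a.+1%:Z.
Proof. by case: i => [[|a]|a] // _; exists a. Qed.

Lemma forall_index_range (r : nat) (P : int -> Prop) :
  (forall i : int, 1 <= i <= r%:Z -> P i) <->
  (forall a : nat, (a < r)%N -> P a.+1%:Z).
Proof.
split=> H => [a ar|i /andP[/int_pos_nat[a ->] ir]]; first by apply: H; lia.
by apply: H; lia.
Qed.

Lemma ext_ind_pos (s : seq nat) (a : nat) : (a < size s)%N ->
  ext_ind s a.+1%:Z = ((nth 0%N s a)%:Z)%:E%E.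
Proof. by move=> sa; rewrite /ext_ind ext_pos (nth_map 0%N). Qed.

Lemma ext_ind_out (s : seq nat) (a : nat) : (size s <= a)%N ->
  ext_ind s a.+1%:Z = -oo%E.
Proof. by move=> sa; rewrite /ext_ind ext_pos nth_default // size_map. Qed.

(** Since [d] is extended by [+oo] on the left, the crossing index is at least
    [x], and it is at most [x + l] since [d] is extended by [-oo] on the right. *)
Lemma crossing_index (c d : seq nat) (x l : nat) (h : int) :
  size c = (x + l)%N -> size d = l ->
  is_min_int (fun i => (ext_ind d (i - x%:Z + 1) < ext_ind c i)%E) h ->
  exists H : nat,
  [/\ h = (x + H)%N%:Z, (H <= l)%N, x = 0%N -> H = 0%N,
      (forall j, (j < H)%N -> (nth 0 c (x + j).-1 <= nth 0 d j)%N)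
    & ((H < l)%N -> (0 < x + H)%N -> (nth 0 d H < nth 0 c (x + H).-1)%N)].
Proof.
move=> szc szd [Ph minh].
have shift (j : nat) : (x + j)%N%:Z - x%:Z + 1 = j.+1%:Z.
  by lia.
have xh : x%:Z <= h.
  rewrite leNgt; apply/negP => hx; move: Ph.
  have lt : h - x%:Z + 1 < 1 by rewrite gtrDr subr_lt0.
  by rewrite /= [ext_ind d _]/ext_ind /ext lt ltNge leey.
have Pl : (ext_ind d ((x + l)%N%:Z - x%:Z + 1) < ext_ind c (x + l)%N)%E.
  rewrite shift ext_ind_out ?szd //; case E: (x + l)%N => [|k] //.
  by rewrite ext_ind_pos ?szc ?E.
have hl := minh _ Pl.
have [H Eh] : exists H : nat, h = (x + H)%N%:Z.
  by exists (`|h|%N - x)%N; lia.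
subst h.
have Hl : (H <= l)%N by lia.
have noP (j : nat) : (j < H)%N -> ~ (ext_ind d j.+1%:Z < ext_ind c (x + j)%N)%E.
  by move=> jH Pj; have := minh (x + j)%N; rewrite /= shift => /(_ Pj); lia.
exists H; split=> //.
- move=> x0; case: H Hl noP {Ph minh hl xh} => // H Hl /(_ 0%N isT) [].
  by rewrite x0 ext_ind_pos ?szd ?(leq_trans _ Hl) //.
- move=> j jH; have := noP j jH; case E: (x + j)%N => [|k] /=.
    by case; rewrite ext_ind_pos // szd (leq_trans jH).
  rewrite !ext_ind_pos ?szd ?szc ?(leq_trans jH) //; last first.
    by move: E jH Hl; clear; lia.
  by rewrite lte_fin => /negP; rewrite -leNgt lez_nat.
move=> Hl'; move: Ph; rewrite shift; case E: (x + H)%N => [|k] //= + _.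
rewrite !ext_ind_pos ?szd ?szc // -E leq_add2l ltnW //.
Qed.

Theorem theorem3p12 (F : fieldType) (m n r : nat) (R : 'M[ratfun F]_(m, n))
    (hr : \rank R = r)
    (eta phi : r.-tuple {poly F}) (c : (n - r).-tuple nat)
    (hR : invariant_rational_functions R eta phi)
    (hc : column_minimal_indices R c)
    (z x : nat) (hx : (x <= minn z (n - r))%N)
    (eps psi : (r + x).-tuple {poly F})
    (hirr : irreducible_fractions eps psi) (hdiv : div_chains eps psi)
    (d : (n - r - x).-tuple nat) (hd : sorted geq d)
    (h : int)
    (hh : is_min_int
            (fun i => (ext_ind d (i - x%:Z + 1) < ext_ind c i)%E) h) :
  (exists W : 'M[ratfun F]_(z, n),
     [/\ \rank (col_mx R W) = (r + x)%N,
         invariant_rational_functions (col_mx R W) eps psi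
       & column_minimal_indices (col_mx R W) d])
  <->
  [/\ forall i : int, h - x%:Z + 1 <= i <= (n - r - x)%N%:Z ->
        ext_ind d i = ext_ind c (i + x%:Z),
      forall i : int, 1 <= i <= r%:Z ->
        (ext_num eps i %| ext_num eta i) &&
        (ext_num eta i %| ext_num eps (i + z%:Z))
    & forall i : int, 1 <= i <= r%:Z ->
        (ext_den psi (i + z%:Z) %| ext_den phi i) &&
        (ext_den phi i %| ext_den psi i)].
Proof.
move: hx; rewrite leq_min => /andP[xz xn].
have rn : (r <= n)%N by rewrite -hr rank_leq_col.
set l := (n - r - x)%N in d hd hh *.
have szd : size d = l by rewrite size_tuple.
have szc : size c = (x + l)%N by rewrite size_tuple /l subnKC.
have en : (r + (x + l))%N = n by rewrite /l subnKC // subnKC.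
have [H [Eh Hl H0 cd cd_lt]] := crossing_index szc szd hh.
have sze : size eps = (r + x)%N := size_tuple eps.
have szp : size psi = (r + x)%N := size_tuple psi.
have szeta : size eta = r := size_tuple eta.
have szphi : size phi = r := size_tuple phi.
have [_ irr ch _] := hR.
have tails : (forall i : int, h - x%:Z + 1 <= i <= l%:Z ->
        ext_ind d i = ext_ind c (i + x%:Z)) <->
    (forall j, (H <= j < l)%N -> nth 0%N d j = nth 0%N c (x + j)).
  have entry (j : nat) : (j < l)%N ->
      ext_ind d j.+1%:Z = ext_ind c (j.+1%:Z + x%:Z) <->
      nth 0%N d j = nth 0%N c (x + j).
    move=> jl; have -> : j.+1%:Z + x%:Z = (x + j).+1%:Z by lia.
    rewrite !ext_ind_pos ?szd ?szc ?ltn_add2l //.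
    by split=> [[]|->].
  split=> [E j /andP[Hj jl]|E i ih].
    by apply/entry => //; apply: E; rewrite Eh; lia.
  have [|a Ea] := @int_pos_nat i; first by move: ih; rewrite Eh; lia.
  have al : (a < l)%N by move: ih; rewrite Ea; lia.
  rewrite Ea; apply/entry => //; apply: E; rewrite al andbT.
  by move: ih; rewrite Eh Ea; lia.
have nums : (forall i : int, 1 <= i <= r%:Z ->
      (ext_num eps i %| ext_num eta i) &&
      (ext_num eta i %| ext_num eps (i + z%:Z)))
    /\ (forall i : int, 1 <= i <= r%:Z ->
      (ext_den psi (i + z%:Z) %| ext_den phi i) &&
      (ext_den phi i %| ext_den psi i)) <->
  (forall i, (i < r)%N -> fdvd (irf eps psi i) (irf eta phi i)) /\
  (forall i, (i < r)%N -> (i + z < r + x)%N ->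
     fdvd (irf eta phi i) (irf eps psi (i + z))).
  have shift a : a.+1%:Z + z%:Z = (a + z).+1%:Z by lia.
  have low a : (a < r)%N -> fdvd (irf eps psi a) (irf eta phi a) <->
      (eps`_a %| eta`_a) && (phi`_a %| psi`_a).
    by move=> ar; apply: irf_dvdP; rewrite ?sze ?szeta // ltn_addr.
  have up a : (a < r)%N -> (a + z < r + x)%N ->
      fdvd (irf eta phi a) (irf eps psi (a + z)) <->
      (eta`_a %| eps`_(a + z)) && (psi`_(a + z) %| phi`_a).
    by move=> ar az; apply: irf_dvdP; rewrite ?sze ?szeta.
  have num0 (s : seq {poly F}) a : ext_num s a.+1%:Z = s`_a.
    by rewrite /ext_num ext_pos.
  have den0 (s : seq {poly F}) a : (a < size s)%N -> ext_den s a.+1%:Z = s`_a.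
    by move=> sa; rewrite /ext_den ext_pos (set_nth_default 0).
  split=> [[/forall_index_range N /forall_index_range D]|[L U]].
    split=> [a ar|a ar az]; have := N a ar; have := D a ar; rewrite shift !num0.
      rewrite (den0 phi) ?(den0 psi a) ?szphi ?szp ?ltn_addr //.
      by case/andP=> _ D2 /andP[N1 _]; apply/(low _ ar); rewrite N1.
    rewrite (den0 phi) ?szphi // (den0 psi (a + z)%N) ?szp //.
    by case/andP=> D1 _ /andP[_ N2]; apply/(up _ ar az); rewrite N2.
  split; apply/forall_index_range => a ar; have /(low _ ar)/andP[L1 L2] := L a ar;
    rewrite shift ?num0 ?(den0 phi) ?(den0 psi a) ?szphi ?szp ?ltn_addr //
      ?L1 ?L2 /= ?andbT;
    have [az|za] := ltnP (a + z) (r + x).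
  - by have /(up _ ar az)/andP[-> _] := U a ar az.
  - by rewrite [eps`_(a + z)]nth_default ?sze ?dvdp0.
  - by rewrite den0 ?szp //; have /(up _ ar az)/andP[_ ->] := U a ar az.
  - by rewrite /ext_den ext_pos nth_default ?szp ?dvd1p.
split=> [[W [rkW hW hdW]]|[tl N D]].
  have [lo hi] := irf_interlacing hR hW.
  have [|N D] := nums.2; last (split=> //; apply/tails).
    split=> i ir; first by apply: lo; rewrite ?sze ?szeta // ltn_addr.
    by move=> iz; apply: hi; rewrite ?sze ?szeta.
  have [c_srt [B mB Bc]] := minimal_indices_sorted hc.
  have [d_srt [B' mB' Bd]] := minimal_indices_sorted hdW.
  have szB : size B = (x + l)%N by rewrite -szc -Bc size_map.
  have szB' : size B' = l by rewrite -szd -Bd size_map.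
  have ker_sub : (right_kernel (col_mx R W) <= right_kernel R)%VS.
    apply/subvP => y yk; rewrite mem_ker.
    rewrite mem_ker mul_col_mx col_mx_eq0 in yk.
    by case/andP: yk.
  move=> j /andP[Hj jl]; have Hl' := leq_ltn_trans Hj jl.
  rewrite -Bd -Bc !(nth_map 0) ?szB ?szB' ?ltn_add2l // [(x + j)%N]addnC.
  apply: (nested_minimal_indices ker_sub mB mB' _ _ _ (H := H));
    rewrite ?Bc ?Bd ?szB' ?Hj //.
  move=> i iH; have pos : (0 < x + H)%N by rewrite addnC; apply: leq_ltn_trans iH.
  have := cd_lt Hl' pos.
  rewrite -Bd -Bc !(nth_map 0) ?szB ?szB' //; last by move: pos Hl'; clear; lia.
  move=> lt; apply: leq_trans lt _.
  have := @sorted_geq_nth _ i (x + H).-1 c_srt; rewrite szc -Bc !(nth_map 0) ?szB.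
  - by apply; move: pos iH Hl'; clear; lia.
  - by move: iH Hl'; clear; lia.
  - by move: pos Hl'; clear; lia.
have [lo hi] := nums.1 (conj N D).
exact: (completion_exists en hr hR hc szc hirr hdiv sze szp hd szd xz H0 cd
         (tails.1 tl) lo hi).
Qed.
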